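(* Let $\eta_0 \in \mathbb{P}$, and let $\eta \in C^0([0,\infty),\mathbb{P})$ be the unique solution with initial data $\eta_0$ of the rescaled coarsening equation in integral form (see context). Then $\mathcal{N}(\eta(\tau)) = S_\tau\,\mathcal{N}(\eta_0)$ for all $\tau \ge 0$.
   Context: Fix an integer $N\ge 1$ and real numbers $p_1,\dots,p_N\ge 0$ with $p_1+\dots+p_N=1$; let $Q(z)=\sum_{j=1}^N p_jz^j$ and, for $\rho\in L^1(\mathbb{R})$, $\mathbb{Q}[\rho]=\sum_{j=1}^N p_j\,\rho^{*j}$, where $\rho^{*j}$ is the $j$-fold convolution power on $\mathbb{R}$. Functions on $(1,\infty)$ are extended by $0$ to $\mathbb{R}$. $L^1=L^1((1,\infty),\mathbb{R})$ and $\mathbb{P}=\{\eta\in L^1((1,\infty),\mathbb{R}_+) : \int_1^\infty \eta(y)\,dy=1\}$. $(S_\tau\eta)(y)=e^\tau\eta(e^\tau y)$ for $y\ge1$ and $0$ for $y<1$ ($\tau\ge 0$); the same formula is used for $\eta\in L^1_{\rm loc}([1,\infty))$. $(T_1\eta)(y)=\eta(y-1)$ for $y\ge2$ and $0$ for $y<2$. Rescaled coarsening equation: for $\eta_0\in\mathbb{P}$ there is a unique $\eta\in C^0([0,\infty),L^1)$ (with trace $\beta\in L^1_{\rm loc}([0,\infty))$) such that $\eta(\tau)=S_\tau\eta_0+\int_0^\tau\beta(s)S_{\tau-s}T_1\mathbb{Q}[\eta(s)]\,ds$ for all $\tau\ge0$ and, for every $\tau_0\ge0$, $\beta(\tau)=e^{\tau-\tau_0}\eta(\tau_0,e^{\tau-\tau_0})$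 for almost all $\tau\in[\tau_0,\tau_0+\log2]$; moreover $\eta(\tau)\in\mathbb{P}$ for all $\tau \ge 0$. The map $\mathcal{N}$: let $\phi$ be the analytic function on $\{|z|<1\}$ with $\phi'(z)=1/(1-Q(z))$, $\phi(0)=0$. For $\rho\in\mathbb{P}$ let $\widehat\rho(\xi)=\int_1^\infty e^{-i\xi x}\rho(x)\,dx$ for $\mathrm{Im}\,\xi\le0$; then $|\widehat\rho(\xi)|<1$ for $\xi\ne0$. $\mathcal{N}(\rho)$ is the unique $w$ supported in $[1,\infty)$ whose Fourier(-Laplace) transform satisfies $\widehat w(\xi)=\phi(\widehat\rho(\xi))$ for $\mathrm{Im}\,\xi<0$ (formally $\mathcal{N}=\mathcal{F}^{-1}\circ\phi\circ\mathcal{F}$); it is a function in $L^1_{\rm loc}([1,\infty),\mathbb{R}_+)$ with $\int_1^\infty e^{-\epsilon x}w(x)\,dx<\infty$ for all $\epsilon>0$. *)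

(* Defs.v *)
From HB Require Import structures.
From mathcomp Require Import all_boot all_order all_algebra.
From mathcomp Require Import all_classical all_reals all_analysis.
From mathcomp Require Import complex.

Set Implicit Arguments.
Unset Strict Implicit.
Unset Printing Implicit Defensive.

Import Order.TTheory GRing.Theory Num.Theory.
Import numFieldNormedType.Exports.

Local Open Scope classical_set_scope.
Local Open Scope ring_scope.
Local Open Scope complex_scope.

(* Elements of L^1 and L^1_loc are represented by functions R -> R, identified
   when they agree almost everywhere; functions on (1, oo) or [1, oo) are
   extended by 0. *)

Section Definitions.
Context {R : realType}.
Implicit Types (f g rho w : R -> R) (p : nat -> R) (N : nat).

Local Notation mu := (@lebesgue_measure R).

Definition L1 f : Prop := mu.-integrable setT (EFin \o f).

Definition L1dist f g : \bar R := 'N[mu]_1[EFin \o (f \- g)%R]%E.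

Definition probability_density rho : Prop :=
  [/\ L1 rho,
      forall y, 0 <= rho y,
      forall y, y <= 1 -> rho y = 0 &
      (\int[mu]_y (rho y)%:E)%E = 1%E].

Definition conv f g (x : R) : R := \int[mu]_y (f y * g (x - y)).

(* The j-fold convolution power, for j >= 1. *)
Definition conv_pow f (j : nat) : R -> R := iter j.-1 (conv f) f.

Definition Qop p N rho (x : R) : R :=
  \sum_(1 <= j < N.+1) p j * conv_pow rho j x.

Definition Qpoly p N (z : R[i]) : R[i] :=
  \sum_(1 <= j < N.+1) (p j)%:C * z ^+ j.

Definition Sop (tau : R) f (y : R) : R :=
  if 1 <= y then expR tau * f (expR tau * y) else 0.

Definition T1op f (y : R) : R := if 2 <= y then f (y - 1) else 0.

(* The L^1-valued simple function \sum_(i < k) 1_(A i) g i, and its integral. *)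
Definition simple_curve (k : nat) (A : nat -> set R) (g : nat -> R -> R)
    (s : R) : R -> R :=
  fun y => \sum_(i < k) \1_(A i) s * g i y.

Definition simple_curve_integral (k : nat) (A : nat -> set R)
    (g : nat -> R -> R) : R -> R :=
  fun y => \sum_(i < k) fine (mu (A i)) * g i y.

(* J is the Bochner integral over D of the curve F : D -> L^1. *)
Definition is_Bochner_integral (D : set R) (F : R -> R -> R) (J : R -> R) :
    Prop :=
  [/\ forall s, D s -> L1 (F s),
      L1 J &
      exists (k : nat -> nat) (A : nat -> nat -> set R)
             (g : nat -> nat -> R -> R),
      [/\ forall n i, (i < k n)%N ->
            [/\ measurable (A n i), A n i `<=` D, (mu (A n i) < +oo)%E &
                L1 (g n i)],
          {ae mu, forall s, D s ->
            L1dist (simple_curve (k n) (A n) (g n) s) (F s)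
              @[n --> \oo] --> 0%E},
          (\int[mu]_(s in D)
             L1dist (simple_curve (k n) (A n) (g n) s) (F s))%E
              @[n --> \oo] --> 0%E &
          L1dist (simple_curve_integral (k n) (A n) (g n)) J
              @[n --> \oo] --> 0%E]].

(* eta is a solution, with values in probability densities and with trace
   beta, of the integral form of the rescaled coarsening equation with initial
   datum eta0. *)
Definition rescaled_coarsening_solution p N (eta0 : R -> R)
    (eta : R -> R -> R) (beta : R -> R) : Prop :=
  [/\ forall tau, 0 <= tau -> probability_density (eta tau),
      forall tau, 0 <= tau ->
        L1dist (eta s) (eta tau)
          @[s --> within [set s | 0 <= s] (nbhs tau)] --> 0%E,
      forall a, 0 <= a -> mu.-integrable `[0, a] (EFin \o beta),
      forall tau, 0 <= tau -> exists2 J : R -> R,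
        is_Bochner_integral `[0, tau]
          (fun s y => beta s * Sop (tau - s) (T1op (Qop p N (eta s))) y) J &
        ae_eq mu setT (eta tau) (Sop tau eta0 \+ J) &
      forall tau0, 0 <= tau0 ->
        {ae mu, forall tau, tau0 <= tau <= tau0 + ln 2 ->
          beta tau = expR (tau - tau0) * eta tau0 (expR (tau - tau0))}].

Definition cexp (z : R[i]) : R[i] :=
  (expR (complex.Re z))%:C * (cos (complex.Im z) +i* sin (complex.Im z)).

Definition Cintegral (f : R -> R[i]) : R[i] :=
  (\int[mu]_x complex.Re (f x)) +i* (\int[mu]_x complex.Im (f x)).

(* Fourier-Laplace transform: the integral of exp(-i xi x) f(x), for
   Im xi < 0, or Im xi <= 0 when f is integrable. *)
Definition FL f (xi : R[i]) : R[i] :=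
  Cintegral (fun x => cexp (- 'i * xi * x%:C) * (f x)%:C).

(* phi(0) = 0 and phi' = 1 / (1 - Q) on the open unit disk; the derivative is
   the complex one, the scalar field being R[i]. *)
Definition is_phi p N (phi : R[i]^o -> R[i]^o) : Prop :=
  phi 0 = 0 /\
  forall z : R[i]^o, `|z| < 1 -> is_derive z 1 phi (1 - Qpoly p N z)^-1.

Definition is_Nop (phi : R[i]^o -> R[i]^o) rho w : Prop :=
  [/\ measurable_fun setT w,
      forall y, y < 1 -> w y = 0,
      forall e, 0 < e ->
        mu.-integrable setT (fun x => (expR (- e * x) * w x)%:E) &
      forall xi : R[i], complex.Im xi < 0 -> FL w xi = phi (FL rho xi)].

(* The function w singled out by is_Nop is unique up to a null set; Nop is a
   choice of a representative. *)
Definition Nop (phi : R[i]^o -> R[i]^o) rho : R -> R :=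
  xget (cst 0) [set w | is_Nop phi rho w].

End Definitions.

(* Main.v *)
Require Import Defs.
From HB Require Import structures.
From mathcomp Require Import all_boot all_order all_algebra.
From mathcomp Require Import all_classical all_reals all_analysis.
From mathcomp Require Import complex.
From mathcomp Require Import measurable_realfun.
From mathcomp Require Import ring lra.

Set Implicit Arguments.
Unset Strict Implicit.
Unset Printing Implicit Defensive.

Import Order.TTheory GRing.Theory Num.Theory.
Import numFieldNormedType.Exports.

Local Open Scope classical_set_scope.
Local Open Scope ring_scope.
Local Open Scope complex_scope.

(* Fix xi with Im xi < 0 and follow g(t) = FL (eta t) (e^t xi). Scaling turns S
   into a truncation and T1 Q[.] into multiplication by an exponential, so that
   on time intervals of length at most ln 2, where the truncation does not cut
   the gain term, the equation together with the trace condition reads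
     g(b) - g(a) = - int_a^b beta(s) e^(- i xi e^s) (1 - Q(g(s))) ds.
   As phi' = 1 / (1 - Q), this gives
     phi(g(b)) = phi(g(a)) - int_1^(e^(b - a)) e^(- i e^a xi u) eta(a)(u) du.
   On the other side, truncating w = N(eta(a)) at e^(b - a) removes the same
   integral with w in place of eta(a); and w = eta(a) almost everywhere on
   [1, 2], because phi(r) - r = O(r^2), so the Laplace transform of
   w - eta(a) is O(e^(- 2 l)). Gluing eta(a) on [1, e^(b - a)) back conversely
   produces a value of N(eta(a)) from one of N(eta(b)), hence N(eta(a)) exists
   exactly when N(eta(b)) does, and its existence need not be proved. *)

(** * Complex-valued Lebesgue integrals *)

(** The frequency e^t xi is chosen because it absorbs S: tested at time t, the gain produced at time
    s enters with frequency e^s xi, whatever t is, and t survives only in the cut. The length ln 2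
    matches three thresholds: the gain lives on [2, oo), so a cut at e^(b - s) <= 2 misses it; the
    trace condition covers windows of that length; and w is compared with eta(a) only below 2. Two
    obstacles shape the analysis. The Bochner integral is given only through approximating simple
    curves, with no measurability of its distances in time, so it is paired with bounded kernels and
    the paired integrand is identified only almost everywhere. And beta is merely integrable, so g
    need not be differentiable at a given time: instead of a pointwise chain rule, the increments of
    phi(g) plus the primitive of the loss are shown to be small compared with those of a monotone
    function. Both appeals to uniqueness, for N and for w = eta(a) below 2, use the Laplace
    transform at positive integers only. *)

Section ComplexIntegral.
Context {R : realType}.
Local Notation mu := (@lebesgue_measure R).
Local Notation normc := (@Normc.normc R).
Local Notation Re := (@complex.Re R).
Local Notation Im := (@complex.Im R).
Implicit Types (D E A B : set R) (f g : R -> R[i]) (z : R[i]).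

Lemma normrC_normc z : `|z| = (normc z)%:C. Proof. by []. Qed.

Lemma normc_ge0 z : 0 <= normc z.
Proof. by case: z => a b; exact: sqrtr_ge0. Qed.

Lemma ler_normcD z w : normc (z + w) <= normc z + normc w.
Proof. exact: le_normcD. Qed.

Lemma normcN1 z : normc (- z) = normc z.
Proof. exact: normcN. Qed.

Lemma ler_normcB z w : normc (z - w) <= normc z + normc w.
Proof. by rewrite -(normcN1 w); exact: ler_normcD. Qed.

Lemma normcBC z w : normc (z - w) = normc (w - z).
Proof. by rewrite -normcN1 opprB. Qed.

Lemma normc_real (r : R) : normc r%:C = `|r|.
Proof. by rewrite /= expr0n/= addr0 sqrtr_sqr. Qed.

Lemma Re_le_normc z : `|Re z| <= normc z.
Proof. by have := normc_ge_Re z; rewrite normrC_normc lecR. Qed.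

Lemma Im_le_normc z : `|Im z| <= normc z.
Proof.
by case: z => a b/=; rewrite -(sqrtr_sqr b) ler_wsqrtr// lerDr sqr_ge0.
Qed.

Lemma normc_le_ReIm z : normc z <= `|Re z| + `|Im z|.
Proof.
case: z => a b/=.
rewrite -[leRHS]ger0_norm ?addr_ge0// -sqrtr_sqr ler_wsqrtr//.
rewrite sqrrD !real_normK ?num_real// -addrA lerD2l lerDr.
by rewrite mulrn_wge0// mulr_ge0.
Qed.

Lemma Re_mulc z w : Re (z * w)
  = Re z * Re w - Im z * Im w.
Proof. by case: z w => a b [c d]. Qed.

Lemma Im_mulc z w : Im (z * w)
  = Re z * Im w + Im z * Re w.
Proof. by case: z w => a b [c d]. Qed.

Lemma Re_addc z w : Re (z + w) = Re z + Re w.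
Proof. by case: z w => a b [c d]. Qed.

Lemma Im_addc z w : Im (z + w) = Im z + Im w.
Proof. by case: z w => a b [c d]. Qed.

Lemma Re_oppc z : Re (- z) = - Re z.
Proof. by case: z. Qed.

Lemma Im_oppc z : Im (- z) = - Im z.
Proof. by case: z. Qed.

Lemma complex_eq z w :
  Re z = Re w -> Im z = Im w -> z = w.
Proof. by case: z w => a b [c d]/= -> ->. Qed.

Definition Cmeasurable D f :=
  measurable_fun D (Re \o f) /\ measurable_fun D (Im \o f).

Definition Cintegrable D f :=
  mu.-integrable D (EFin \o (Re \o f)) /\
  mu.-integrable D (EFin \o (Im \o f)).

(** On [setT] this unfolds to [Cintegral], so that [FLE] holds by computation. *)
Definition Cint D f : R[i] :=
  (\int[mu]_(x in D) Re (f x)) +i* (\int[mu]_(x in D) Im (f x)).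

Lemma eq_Cint D f g : {in D, f =1 g} -> Cint D f = Cint D g.
Proof.
by move=> fg; apply: complex_eq; apply: eq_Rintegral => x xD; rewrite fg.
Qed.


Lemma eq_integrable_real D (h k : R -> R) : measurable D ->
  (forall x, D x -> h x = k x) ->
  mu.-integrable D (EFin \o h) -> mu.-integrable D (EFin \o k).
Proof.
move=> mD hk ih; apply: (eq_integrable _ _ _ _ ih) => // x /set_mem Dx /=.
by rewrite hk.
Qed.

Lemma eq_Cintegrable D f g : measurable D ->
  {in D, f =1 g} -> Cintegrable D f -> Cintegrable D g.
Proof.
move=> mD fg [h1 h2]; split.
  by apply: (eq_integrable _ _ _ _ h1) => // x xD /=; rewrite fg.
by apply: (eq_integrable _ _ _ _ h2) => // x xD /=; rewrite fg.
Qed.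

Lemma CintegrableS D E f : measurable D -> measurable E -> E `<=` D ->
  Cintegrable D f -> Cintegrable E f.
Proof. by move=> mD mE ED [h1 h2]; split; [apply: integrableS h1|apply: integrableS h2]. Qed.

Lemma Cintegrable_measurable D f : Cintegrable D f -> Cmeasurable D f.
Proof.
by move=> [/integrableP[/measurable_EFinP h1 _] /integrableP[/measurable_EFinP h2 _]].
Qed.

Lemma le_integrable_real D (f g : R -> R) : measurable D -> measurable_fun D f ->
  (forall x, D x -> `|f x| <= g x) -> mu.-integrable D (EFin \o g) ->
  mu.-integrable D (EFin \o f).
Proof.
move=> mD mf fg; apply: le_integrable => //; first exact/measurable_EFinP.
move=> x Dx /=; rewrite lee_fin (le_trans (fg x Dx))//; exact: ler_norm.
Qed.

Lemma le_Cintegrable D f (g : R -> R) : measurable D -> Cmeasurable D f ->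
  (forall x, D x -> normc (f x) <= g x) -> mu.-integrable D (EFin \o g) ->
  Cintegrable D f.
Proof.
move=> mD [m1 m2] fg ig; split; apply: le_integrable_real ig => // x Dx;
  apply: le_trans (fg x Dx); [exact: Re_le_normc|exact: Im_le_normc].
Qed.

Lemma CmeasurableM D f g : Cmeasurable D f -> Cmeasurable D g ->
  Cmeasurable D (fun x => f x * g x).
Proof.
move=> [f1 f2] [g1 g2]; split.
  rewrite (_ : _ \o _ = (Re \o f) \* (Re \o g) \- (Im \o f) \* (Im \o g)).
    by apply: measurable_funB; exact: measurable_funM.
  by apply/funext => x /=; rewrite Re_mulc.
rewrite (_ : _ \o _ = (Re \o f) \* (Im \o g) \+ (Im \o f) \* (Re \o g)).
  by apply: measurable_funD; exact: measurable_funM.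
by apply/funext => x /=; rewrite Im_mulc.
Qed.

Lemma Cmeasurable_real D (h : R -> R) : measurable_fun D h ->
  Cmeasurable D (fun x => (h x)%:C).
Proof. by move=> mh; split => //; exact: measurable_cst. Qed.

Lemma integrableZl_real D (h : R -> R) c : measurable D ->
  mu.-integrable D (EFin \o h) -> mu.-integrable D (EFin \o (fun x => c * h x)).
Proof. by move=> mD ih; exact: (integrableZl _ c ih). Qed.

Lemma integrableD_real D (h k : R -> R) : measurable D ->
  mu.-integrable D (EFin \o h) -> mu.-integrable D (EFin \o k) ->
  mu.-integrable D (EFin \o (fun x => h x + k x)).
Proof. by move=> mD ih ik; exact: (integrableD _ ih ik). Qed.

Lemma CintegrableD D f g : measurable D -> Cintegrable D f -> Cintegrable D g ->
  Cintegrable D (fun x => f x + g x).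
Proof.
move=> mD [f1 f2] [g1 g2]; split.
  apply: (eq_integrable_real mD (h := (fun x => Re (f x) + Re (g x)))) => //.
    by move=> x _ /=; rewrite Re_addc.
  exact: integrableD_real.
apply: (eq_integrable_real mD (h := (fun x => Im (f x) + Im (g x)))) => //.
  by move=> x _ /=; rewrite Im_addc.
exact: integrableD_real.
Qed.

Lemma CintegrableZ D f z : measurable D -> Cintegrable D f ->
  Cintegrable D (fun x => z * f x).
Proof.
move=> mD [f1 f2]; split.
  apply: (eq_integrable_real mD (h := (fun x => Re z * Re (f x) + (- Im z) * Im (f x)))) => //.
    by move=> x _ /=; rewrite Re_mulc mulNr.
  by apply: integrableD_real => //; exact: integrableZl_real.
apply: (eq_integrable_real mD (h := (fun x => Re z * Im (f x) + Im z * Re (f x)))) => //.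
  by move=> x _ /=; rewrite Im_mulc.
by apply: integrableD_real => //; exact: integrableZl_real.
Qed.

Lemma CintegrableN D f : measurable D -> Cintegrable D f ->
  Cintegrable D (fun x => - f x).
Proof.
move=> mD /(CintegrableZ (-1) mD); apply: eq_Cintegrable => // x _.
by rewrite mulN1r.
Qed.

Lemma CintegrableB D f g : measurable D -> Cintegrable D f -> Cintegrable D g ->
  Cintegrable D (fun x => f x - g x).
Proof. by move=> mD fi gi; apply: CintegrableD => //; exact: CintegrableN. Qed.

Lemma CintD D f g : measurable D -> Cintegrable D f -> Cintegrable D g ->
  Cint D (fun x => f x + g x) = Cint D f + Cint D g.
Proof.
move=> mD [f1 f2] [g1 g2]; apply: complex_eq => /=.
  under eq_Rintegral do rewrite Re_addc.
  exact: RintegralD.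
under eq_Rintegral do rewrite Im_addc.
exact: RintegralD.
Qed.

Lemma CintZ D f z : measurable D -> Cintegrable D f ->
  Cint D (fun x => z * f x) = z * Cint D f.
Proof.
move=> mD [f1 f2]; apply: complex_eq; rewrite ?Re_mulc ?Im_mulc /=.
  under eq_Rintegral do rewrite Re_mulc.
  by rewrite RintegralB ?RintegralZl//; exact: integrableZl_real.
under eq_Rintegral do rewrite Im_mulc.
by rewrite RintegralD ?RintegralZl//; exact: integrableZl_real.
Qed.

Lemma CintN D f : measurable D -> Cintegrable D f ->
  Cint D (fun x => - f x) = - Cint D f.
Proof.
move=> mD fi; rewrite -mulN1r -CintZ//.
by apply: eq_Cint => x _; rewrite mulN1r.
Qed.

Lemma CintB D f g : measurable D -> Cintegrable D f -> Cintegrable D g ->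
  Cint D (fun x => f x - g x) = Cint D f - Cint D g.
Proof.
by move=> mD fi gi; rewrite CintD ?CintN//; exact: CintegrableN.
Qed.

(** Rotation argument: with z the integral, |z|^2 is the real part of the integral of conj(z) f,
    which is at most |z| times the integral of g. *)
Lemma normc_Cint_le D f (g : R -> R) : measurable D -> Cintegrable D f ->
  (forall x, D x -> normc (f x) <= g x) -> mu.-integrable D (EFin \o g) ->
  normc (Cint D f) <= \int[mu]_(x in D) g x.
Proof.
move=> mD fi fg ig; set z := Cint D f.
have G0 : 0 <= \int[mu]_(x in D) g x.
  by apply: Rintegral_ge0 => x Dx; rewrite (le_trans _ (fg _ Dx))// normc_ge0.
have [z0|z0] := eqVneq (normc z) 0; first by rewrite z0.
have zp : 0 < normc z by rewrite lt_neqAle eq_sym z0 normc_ge0.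
rewrite -(ler_pM2l zp).
have zE : normc z * normc z = Re (z^* * z).
  rewrite -expr2; case: z {z0 zp} => a b /=; rewrite sqr_sqrtr ?addr_ge0 ?sqr_ge0//.
  by rewrite mulNr opprK -!expr2.
have nzC : normc z^* = normc z by case: z {z0 zp zE} => a b/=; rewrite sqrrN.
rewrite zE -CintZ// -RintegralZl//=.
have [zf _] := CintegrableZ (z^*) mD fi.
apply: le_Rintegral => //; first exact: integrableZl_real.
move=> x Dx; rewrite (le_trans (ler_norm _))// (le_trans (Re_le_normc _))//.
by rewrite Normc.normcM nzC ler_wpM2l ?normc_ge0// fg.
Qed.

Lemma ae_imply (P Q : R -> Prop) : (forall x, P x -> Q x) ->
  {ae mu, forall x, P x} -> {ae mu, forall x, Q x}.
Proof. by apply: filterS; exact: (ae_filter_ringOfSetsType mu). Qed.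

Lemma ae_imply2 (P Q S : R -> Prop) : (forall x, P x -> Q x -> S x) ->
  {ae mu, forall x, P x} -> {ae mu, forall x, Q x} -> {ae mu, forall x, S x}.
Proof. by apply: filterS2; exact: (ae_filter_ringOfSetsType mu). Qed.

Lemma ae_eq_Rintegral D (h k : R -> R) : measurable D ->
  measurable_fun D h -> measurable_fun D k -> ae_eq mu D h k ->
  \int[mu]_(x in D) h x = \int[mu]_(x in D) k x.
Proof.
move=> mD mh mk hk; congr fine; apply: ae_eq_integral => //;
  [exact/measurable_EFinP|exact/measurable_EFinP|].
by apply: ae_imply hk => x /= hk Dx; rewrite hk.
Qed.

Lemma ae_eq_Cint D f g : measurable D -> Cmeasurable D f -> Cmeasurable D g ->
  {ae mu, forall x, D x -> f x = g x} -> Cint D f = Cint D g.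
Proof.
move=> mD [f1 f2] [g1 g2] fg; apply: complex_eq; apply: ae_eq_Rintegral => //;
  by apply: ae_imply fg => x /= fg Dx; rewrite fg.
Qed.

Lemma Cint_mkcond D f : Cint D f = Cint setT (fun x => (\1_D x)%:C * f x).
Proof.
apply: complex_eq => /=; rewrite Rintegral_mkcond; apply: eq_Rintegral => x _;
  rewrite patchE ?Re_mulc ?Im_mulc indicE /=; case: (x \in D);
  by rewrite ?mul1r ?mul0r ?subr0 ?addr0.
Qed.

Lemma Cint_setU A B f : measurable A -> measurable B ->
  Cintegrable (A `|` B) f -> [disjoint A & B] ->
  Cint (A `|` B) f = Cint A f + Cint B f.
Proof. by move=> mA mB [f1 f2] AB; apply: complex_eq; exact: Rintegral_setU. Qed.

End ComplexIntegral.

(** * Changes of variables *)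

Section ImageDensity.
Local Open Scope ereal_scope.
Context {R : realType}.
Local Notation mu := (@lebesgue_measure R).
Local Notation Rm := (measurableTypeR R).
Variables (T q : R -> R).
Hypotheses (mT : measurable_fun [set: Rm] (T : Rm -> Rm))
  (mq : measurable_fun [set: Rm] q) (q0 : forall x, (0 <= q x)%R).

(** The push-forward under [T] of the measure with density [q]. Lebesgue measure is determined by
    its values on half-open intervals, so [HI] alone identifies the two; no derivative of [T]
    enters. *)
Definition image_density (A : set Rm) : \bar R :=
  \int[mu]_(x in (T : Rm -> Rm) @^-1` A) (q x)%:E.

Let mpre (A : set Rm) : measurable A -> measurable ((T : Rm -> Rm) @^-1` A).
Proof. by move=> mA; rewrite -[X in measurable X]setTI; exact: mT. Qed.

Let image_density0 : image_density set0 = 0.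
Proof. by rewrite /image_density preimage_set0 integral_set0. Qed.

Let image_density_ge0 A : 0 <= image_density A.
Proof. by apply: integral_ge0 => x _; rewrite lee_fin. Qed.

Let image_density_sigma_additive : semi_sigma_additive image_density.
Proof.
move=> F mF tF mUF; rewrite /image_density preimage_bigcup.
rewrite ge0_integral_bigcup//.
- apply: is_cvg_ereal_nneg_natsum_cond => n _ _.
  exact: image_density_ge0.
- by move=> n; exact: mpre.
- by apply/measurable_EFinP; apply: measurable_funS mq.
- by move=> x _; rewrite lee_fin.
- apply/trivIsetP => /= i j _ _ ij; rewrite -preimage_setI.
  by move/trivIsetP : tF => /(_ _ _ _ _ ij) ->//; rewrite preimage_set0.
Qed.

HB.instance Definition _ := isMeasure.Build _ _ _ image_density
  image_density0 image_density_ge0 image_density_sigma_additive.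

Hypothesis HI : forall a b : R, (a < b)%R ->
  \int[mu]_(x in (T : Rm -> Rm) @^-1` `]a, b]) (q x)%:E = (b - a)%:E.

Lemma image_density_lebesgue (A : set Rm) : measurable A -> mu A = image_density A.
Proof.
apply: (@lebesgue_measure_unique R image_density) => _ [[a b]] _ <- /=.
rewrite lebesgue_measure_itv/= lte_fin; case: ltP => ab.
  by rewrite /image_density HI.
rewrite [X in image_density X](_ : _ = set0) ?image_density0//.
by apply/seteqP; split => // x/=; rewrite in_itv/= => /andP[/lt_le_trans h /h]; rewrite ltNge ab.
Qed.

Import HBNNSimple.

(** For indicators this is [image_density_lebesgue]; simple functions follow by linearity, and [f]
    by monotone convergence on both sides. *)
Lemma ge0_substitution (f : R -> \bar R) : measurable_fun [set: Rm] f -> (forall x, 0 <= f x) ->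
  \int[mu]_x f x = \int[mu]_x ((q x)%:E * f (T x)).
Proof.
move=> mf f0; pose h := nnsfun_approx (@measurableT _ Rm) mf.
have hf x : (EFin \o (fun n => h n x)) n @[n --> \oo] --> f x.
  exact: cvg_nnsfun_approx.
have -> : \int[mu]_x f x = lim (\int[mu]_x (EFin \o h n) x @[n --> \oo]).
  have fE x : f x = lim ((EFin \o h n) x @[n --> \oo]).
    by apply/esym/cvg_lim => //; exact: hf.
  under eq_integral => x _ do rewrite fE.
  apply: monotone_convergence => //.
  - by move=> n; apply/measurable_EFinP; exact/measurable_funP.
  - by move=> n x _ //=; rewrite lee_fin.
  - by move=> x _ a b ab; rewrite lee_fin; exact/lefP/nd_nnsfun_approx.
have -> : \int[mu]_x ((q x)%:E * f (T x)) =
    lim (\int[mu]_x ((q x)%:E * (h n (T x))%:E) @[n --> \oo]).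
  have fE x : (q x)%:E * f (T x) = lim (((q x)%:E * (h n (T x))%:E) @[n --> \oo]).
    by apply/esym/cvg_lim => //; apply: cvgeZl => //; exact: hf.
  under eq_integral => x _ do rewrite fE.
  apply: monotone_convergence => //.
  - move=> n; apply/measurable_EFinP/measurable_funM => //.
    by apply: measurableT_comp mT.
  - by move=> n x _ //=; rewrite mule_ge0 ?lee_fin.
  - move=> x _ a b ab; apply: lee_wpmul2l; rewrite lee_fin//.
    by have /lefP := nd_nnsfun_approx (@measurableT _ Rm) mf ab; exact.
congr (lim (_ @ \oo)); apply/funext => n.
transitivity (\int[mu]_x
   (\sum_(y \in range (h n)) (y * \1_(h n @^-1` [set y]) x)%:E)).
  by apply: eq_integral => t tE; rewrite /= fimfunE -fsumEFin.
rewrite ge0_integral_fsum//; last 2 first.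
- by move=> y; apply/measurable_EFinP/measurable_funM.
- by move=> m y Ey; exact: nnfun_muleindic_ge0.
have hTE x : (h n (T x))%:E = \sum_(y \in range (h n)) (y * \1_(h n @^-1` [set y]) (T x))%:E.
  by rewrite fsumEFin// -fimfunE.
under [RHS]eq_integral => x _.
  rewrite hTE ge0_mule_fsumr => [|y]; last exact: nnfun_muleindic_ge0.
  over.
have mind y : measurable_fun [set: Rm] (\1_(h n @^-1` [set y]) \o T : Rm -> R).
  by apply: measurableT_comp mT => //; exact: measurable_indic.
rewrite ge0_integral_fsum//; last 2 first.
- by move=> y; apply: emeasurable_funM; apply/measurable_EFinP => //;
    apply: measurable_funM => //; exact: mind.
- by move=> y x _; rewrite mule_ge0 ?lee_fin//; exact: nnfun_muleindic_ge0.
apply: eq_fsbigr => r rhn.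
rewrite integralZl_indic_nnsfun// integral_indic// setIT.
transitivity (r%:E * image_density (h n @^-1` [set r])).
  by congr (_ * _); exact: image_density_lebesgue.
rewrite /image_density.
under [RHS]eq_integral do rewrite EFinM muleCA.
have [r0|r0] := ltP r (0:R)%R.
  rewrite preimage_nnfun0// preimage_set0 integral_set0 mule0.
  under eq_integral do rewrite indic0 /= !mule0.
  by rewrite integral0.
rewrite ge0_integralZl//; last 2 first.
- apply: emeasurable_funM; apply/measurable_EFinP => //; exact: mind.
- by move=> x _; rewrite mule_ge0 ?lee_fin.
congr (_ * _); rewrite [LHS]integral_mkcond; apply: eq_integral => x _.
by rewrite epatch_indic muleC.
Qed.

Lemma integrable_substitution (f : R -> R) : mu.-integrable setT (EFin \o f) ->
  mu.-integrable setT (EFin \o (fun x => q x * f (T x)))%R.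
Proof.
move=> /integrableP[/measurable_EFinP mf fi]; apply/integrableP; split.
  by apply/measurable_EFinP/measurable_funM => //; apply: measurableT_comp mT.
move: fi; rewrite ge0_substitution//; last by do 2 apply: measurableT_comp => //.
congr (_ < _); apply: eq_integral => x _.
by rewrite /= normrM EFinM (ger0_norm (q0 x)).
Qed.

Lemma Rintegral_substitution (f : R -> R) : measurable_fun [set: Rm] f ->
  (\int[mu]_x f x = \int[mu]_x (q x * f (T x)))%R.
Proof.
move=> mf; congr fine; rewrite integralE [RHS]integralE.
rewrite ge0_substitution//; last exact/measurable_funepos/measurable_EFinP.
rewrite [X in _ - X]ge0_substitution//; last exact/measurable_funeneg/measurable_EFinP.
congr (_ - _); apply: eq_integral => x _.
  by rewrite !funeposE maxe_pMr ?lee_fin// mule0.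
by rewrite !funenegE maxe_pMr ?lee_fin// mule0 muleN.
Qed.

End ImageDensity.

Section Substitutions.
Context {R : realType}.
Local Notation mu := (@lebesgue_measure R).
Local Notation Rm := (measurableTypeR R).

Section Affine.
Variables (a c : R).
Hypothesis a0 : 0 < a.

Let T (x : R) := a * x + c.

Let mT : measurable_fun [set: Rm] (T : Rm -> Rm).
Proof.
apply: (@measurable_funD _ Rm _ _ (fun x => a * x) (fun=> c)) => //.
exact: measurable_funM.
Qed.

Let HT (u v : R) : u < v ->
  (\int[mu]_(x in (T : Rm -> Rm) @^-1` `]u, v]) a%:E = (v - u)%:E)%E.
Proof.
move=> uv; rewrite (_ : _ @^-1` _ = `](u - c) / a, (v - c) / a]%classic).
  rewrite integral_cst//= lebesgue_measure_itv/= lte_fin.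
  rewrite ltr_pM2r ?invr_gt0// ltrD2r uv -EFinD -EFinM -mulrBl.
  by congr (_%:E); field; rewrite gt_eqF.
apply/seteqP; split => x /=; rewrite !in_itv/= /T.
  by rewrite ltr_pdivrMr// ler_pdivlMr// ltrBlDr lerBrDr mulrC.
by rewrite ltr_pdivrMr// ler_pdivlMr// ltrBlDr lerBrDr mulrC.
Qed.

Lemma integrable_affine (f : R -> R) : mu.-integrable setT (EFin \o f) ->
  mu.-integrable setT (EFin \o (fun x => a * f (a * x + c))).
Proof.
apply: (@integrable_substitution R T (fun=> a)) => //.
  by move=> x; exact: ltW.
Qed.

Lemma Rintegral_affine (f : R -> R) : measurable_fun [set: Rm] f ->
  \int[mu]_x f x = \int[mu]_x (a * f (a * x + c)).
Proof.
apply: (@Rintegral_substitution R T (fun=> a)) => //.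
by move=> x; exact: ltW.
Qed.

Lemma ge0_integral_affine (f : R -> \bar R) : measurable_fun [set: Rm] f ->
  (forall x, 0 <= f x)%E ->
  (\int[mu]_x f x = \int[mu]_x (a%:E * f (a * x + c)%R))%E.
Proof.
apply: (@ge0_substitution R T (fun=> a)) => //.
by move=> x; exact: ltW.
Qed.

End Affine.

Section Exponential.

(* An increasing C^1 bijection of R onto itself; on [0, oo) its derivative is
   that of exp. *)
Let T (x : R) := if x <= 0 then x else expR x - 1.
Let q (x : R) := if x <= 0 then 1 else expR x.

Let mneg : measurable_fun [set: Rm] (fun x : Rm => x <= 0).
Proof. by apply: measurable_fun_ler. Qed.

Let mT : measurable_fun [set: Rm] (T : Rm -> Rm).
Proof.
apply: (measurable_fun_ifT (g := (id : Rm -> Rm)) (h := (fun x : Rm => expR x - 1 : Rm))) => //.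
by apply: measurable_funB => //; exact: measurable_expR.
Qed.

Let mq : measurable_fun [set: Rm] q.
Proof. by apply: measurable_fun_ifT => //; exact: measurable_expR. Qed.

Let q0 x : 0 <= q x.
Proof. by rewrite /q; case: ifP => // _; exact: expR_ge0. Qed.

Let intexp (s t : R) : s <= t ->
  (\int[mu]_(x in `]s, t]) (expR x)%:E = (expR t - expR s)%:E)%E.
Proof.
rewrite le_eqVlt => /predU1P[->|st].
  by rewrite set_itvoc0 integral_set0 subrr.
rewrite integral_itv_obnd_cbnd; last first.
  by apply/measurable_EFinP; apply: measurable_funTS; exact: measurable_expR.
rewrite (continuous_FTC2 (F := expR)) ?EFinB//.
- by apply: continuous_subspaceT; exact: continuous_expR.
- split => //.
  + by apply: cvg_at_right_filter; exact: continuous_expR.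
  + by apply: cvg_at_left_filter; exact: continuous_expR.
- by move=> x _; rewrite derive1E derive_val.
Qed.

Let HT (u v : R) : u < v ->
  (\int[mu]_(x in (T : Rm -> Rm) @^-1` `]u, v]) (q x)%:E = (v - u)%:E)%E.
Proof.
move=> uv.
(* [L] is the inverse of [T], so the preimage of an interval is again an interval; its [q]-mass is
   computed separately on the two sides of 0. *)
pose L (y : R) := if y <= 0 then y else ln (1 + y).
have TL x y : (y < T x) = (L y < x).
  rewrite /T /L; case: ifP => x0; case: ifP => y0 //.
  - have y1 : 0 < y by rewrite ltNge y0.
    have l0 : 0 < ln (1 + y) by rewrite ln_gt0// ltrDl.
    by rewrite !ltNge (ltW (le_lt_trans x0 y1)) (ltW (le_lt_trans x0 l0)).
  - have x1 : 0 < x by rewrite ltNge x0.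
    have e0 : 0 < expR x - 1 by rewrite subr_gt0 expR_gt1.
    by rewrite (le_lt_trans y0 x1) (le_lt_trans y0 e0).
  - have y1 : 0 < y by rewrite ltNge y0.
    by rewrite -[RHS]ltr_expR lnK ?posrE ?addr_gt0// ltrBrDl.
have -> : (T : Rm -> Rm) @^-1` `]u, v] = `]L u, L v]%classic.
  by apply/seteqP; split => x /=; rewrite !in_itv/= TL !leNgt TL.
have uvL : L u <= L v.
  rewrite /L; case: ifP => u0; case: ifP => v0 //; first exact: ltW.
  - by rewrite (le_trans u0)// ln_ge0// lerDl ltW// ltNge v0.
  - by move: u0; rewrite (le_trans (ltW uv) v0).
  - have u1 : 0 < u by rewrite ltNge u0.
    have v1 : 0 < v by rewrite ltNge v0.
    by rewrite ler_ln ?posrE ?addr_gt0// lerD2l ltW.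
have I1 (s t : R) : s <= t -> t <= 0 ->
    (\int[mu]_(x in `]s, t]) (q x)%:E = (t - s)%:E)%E.
  move=> st t0; under eq_integral.
    move=> x; rewrite inE/= in_itv/= => /andP[_ xt].
    by rewrite /q (le_trans xt t0); over.
  rewrite integral_cst//= lebesgue_measure_itv/= lte_fin mul1e.
  by move: st; rewrite le_eqVlt => /predU1P[->|->//]; rewrite ltxx subrr.
have I2 (s t : R) : s <= t -> 0 <= s ->
    (\int[mu]_(x in `]s, t]) (q x)%:E = (expR t - expR s)%:E)%E.
  move=> st s0; rewrite -intexp//; apply: eq_integral => x.
  rewrite inE/= in_itv/= => /andP[sx _].
  by rewrite /q leNgt (le_lt_trans s0 sx).
move: uvL; rewrite /L; case: ifP => u0; case: ifP => v0 => uvL.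
- exact: I1.
- have v1 : 0 < v by rewrite ltNge v0.
  have l0 : 0 <= ln (1 + v) by rewrite ln_ge0// lerDl ltW.
  rewrite (@itv_bndbnd_setU _ _ _ (BRight 0)) ?bnd_simp//.
  rewrite ge0_integral_setU//=; last 3 first.
  + by apply/measurable_EFinP; apply: measurable_funTS; exact: mq.
  + by move=> x _; rewrite lee_fin.
  + apply/disj_setPS => x /=; rewrite !in_itv/= => -[/andP[_ x0] /andP[x1 _]].
    by move: x0; rewrite leNgt x1.
  rewrite I1// I2// expR0 lnK ?posrE ?addr_gt0// -EFinD.
  by congr (_%:E); ring.
- by move: u0; rewrite (le_trans (ltW uv) v0).
- have u1 : 0 < u by rewrite ltNge u0.
  have v1 : 0 < v by rewrite ltNge v0.
  rewrite I2// ?ln_ge0 ?lerDl ?(ltW u1)//.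
  by rewrite !lnK ?posrE ?addr_gt0//; congr (_%:E); ring.
Qed.

Lemma Rintegral_exp (f : R -> R) (s : R) : 0 <= s ->
  mu.-integrable `[1, expR s[ (EFin \o f) ->
  mu.-integrable `[0, s[ (EFin \o (fun x => expR x * f (expR x))) /\
  \int[mu]_(x in `[1, expR s[) f x = \int[mu]_(x in `[0, s[) (expR x * f (expR x)).
Proof.
move=> s0 fi.
have mI1 : measurable (`[1, expR s[ : set Rm) by [].
have mI2 : measurable (`[0, s[ : set Rm) by [].
pose g := f \_ `[1, expR s[.
have gi : mu.-integrable setT (EFin \o g).
  move: fi => /(integrable_mkcond _ mI1).1.
  by rewrite restrict_EFin.
(* [T] fixes 0, so a shift by 1 comes first: [T x + 1] is [expR x] for [0 <= x]. *)
have g1i := integrable_affine 1 ltr01 gi.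
have g2i := integrable_substitution mT mq q0 HT g1i.
have eg1 x : (1 <= expR x) = (0 <= x) by rewrite -[RHS]ler_expR expR0.
have E x : ((fun x => expR x * f (expR x)) \_ `[0, s[) x = q x * (1 * g (1 * T x + 1)).
  rewrite patchE mem_setE in_itv/= !mul1r /q /T /g patchE mem_setE in_itv/=.
  case: ifPn => [/andP[x0 xs]|xs].
    case: ifPn => [xn0|xp].
      have x00 : x = 0 by apply/eqP; rewrite eq_le xn0.
      by rewrite x00 expR0 add0r lexx expR_gt1 -x00 xs.
    by rewrite subrK ltr_expR xs eg1 x0.
  case: ifPn => [xn0|xp].
    rewrite ifN ?mulr0//; apply: contra xs => /andP[x1 xs].
    have x00 : x = 0 by apply/eqP; rewrite eq_le xn0/= -(lerD2r 1) add0r.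
    by rewrite x00 lexx/=; move: xs; rewrite x00 add0r expR_gt1.
  rewrite ifN ?mulr0// subrK; apply: contra xs.
  by rewrite ltr_expR eg1.
split.
  apply/(integrable_mkcond _ mI2); rewrite restrict_EFin.
  by apply: eq_integrable_real g2i => //= x _; rewrite E.
rewrite [LHS]Rintegral_mkcond [RHS]Rintegral_mkcond -/g.
have mg : measurable_fun [set: Rm] g by case/integrableP : gi => /measurable_EFinP.
have mg1 : measurable_fun [set: Rm] (fun x => 1 * g (1 * x + 1)).
  by case/integrableP : g1i => /measurable_EFinP.
rewrite (Rintegral_affine 1 ltr01 mg).
rewrite (Rintegral_substitution mT mq q0 HT mg1).
by apply: eq_Rintegral => x _; rewrite E.
Qed.

End Exponential.
End Substitutions.

(** * The Fourier-Laplace transform *)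

Section Transform.
Context {R : realType}.
Local Notation mu := (@lebesgue_measure R).
Local Notation Rm := (measurableTypeR R).
Local Notation normc := (@Normc.normc R).
Local Notation Re := (@complex.Re R).
Local Notation Im := (@complex.Im R).
Implicit Types (f g : R -> R) (xi : R[i]) (r x y s : R).

Definition ker xi x : R[i] := cexp (- 'i * xi * x%:C).

Lemma kerE xi x : ker xi x =
  (expR (Im xi * x) * cos (Re xi * x)) +i* (- (expR (Im xi * x) * sin (Re xi * x))).
Proof.
rewrite /ker /cexp; case: xi => a b /=.
have -> : (- 0 * a - - 1 * b) * x - (- 0 * b + - 1 * a) * 0 = b * x by ring.
have -> : (- 0 * a - - 1 * b) * 0 + (- 0 * b + - 1 * a) * x = - (a * x) by ring.
rewrite cosN sinN; apply: complex_eq => /=; ring.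
Qed.

Lemma kerD xi x y : ker xi (x + y) = ker xi x * ker xi y.
Proof.
rewrite !kerE !mulrDr expRD cosD sinD; apply: complex_eq => /=; ring.
Qed.

Lemma ker_scale xi (c x : R) : ker (c%:C * xi) x = ker xi (c * x).
Proof.
by rewrite !kerE; case: xi => a b/=; rewrite !mul0r subr0 addr0 !mulrA !(mulrC c).
Qed.

Lemma normc_ker xi x : normc (ker xi x) = expR (Im xi * x).
Proof.
by rewrite kerE /= sqrrN !exprMn -mulrDr cos2Dsin2 mulr1 sqrtr_sqr ger0_norm ?expR_ge0.
Qed.

Lemma normc_ker_le1 xi x : Im xi <= 0 -> 0 <= x -> normc (ker xi x) <= 1.
Proof.
move=> xi0 x0; rewrite normc_ker -[leRHS](@expR0 R) ler_expR.
by rewrite mulr_le0_ge0.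
Qed.

Lemma measurable_ker D xi : Cmeasurable D (ker xi).
Proof.
have m1 (c : R) : measurable_fun [set: R] (fun x : R => c * x).
  exact: measurable_funM.
split; apply: measurable_funTS.
  rewrite (_ : _ \o _ = (fun x => expR (Im xi * x) * cos (Re xi * x))); last first.
    by apply/funext => x; rewrite [LHS]/comp kerE.
  apply: measurable_funM; first by apply: measurableT_comp => //; exact: measurable_expR.
  apply: measurableT_comp => //.
  by apply: continuous_measurable_fun; exact: continuous_cos.
rewrite (_ : _ \o _ = (fun x => - (expR (Im xi * x) * sin (Re xi * x)))); last first.
  by apply/funext => x; rewrite [LHS]/comp kerE.
apply: measurableT_comp => //.
apply: measurable_funM; first by apply: measurableT_comp => //; exact: measurable_expR.
apply: measurableT_comp => //.
by apply: continuous_measurable_fun; exact: continuous_sin.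
Qed.

Definition kmul xi f x : R[i] := ker xi x * (f x)%:C.

Lemma FLE f xi : FL f xi = Cint setT (kmul xi f).
Proof. by []. Qed.

Lemma measurable_kmul D xi f : measurable_fun D f -> Cmeasurable D (kmul xi f).
Proof.
by move=> mf; apply: CmeasurableM; [exact: measurable_ker|exact: Cmeasurable_real].
Qed.

Lemma normc_kmul xi f x : normc (kmul xi f x) = expR (Im xi * x) * `|f x|.
Proof. by rewrite /kmul Normc.normcM normc_ker normc_real. Qed.

Lemma integrable_kmul D xi f : measurable D -> measurable_fun D f ->
  mu.-integrable D (EFin \o (fun x => expR (Im xi * x) * f x)) ->
  Cintegrable D (kmul xi f).
Proof.
move=> mD mf fi.
apply: (le_Cintegrable mD (measurable_kmul xi mf)
  (g := (fun x => `|expR (Im xi * x) * f x|))).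
  by move=> x _; rewrite normc_kmul normrM (ger0_norm (expR_ge0 _)).
move: fi => /integrable_abse; apply: eq_integrable_real => //.
Qed.

Lemma L1_measurable f : L1 f -> measurable_fun setT f.
Proof. by move=> /integrableP[/measurable_EFinP]. Qed.

Lemma integrable_kmul_L1 D xi f : measurable D -> (forall x, D x -> 0 <= x) ->
  Im xi <= 0 -> L1 f -> Cintegrable D (kmul xi f).
Proof.
move=> mD D0 xi0 f1.
have mf : measurable_fun D f by apply: measurable_funTS; exact: L1_measurable.
apply: (le_Cintegrable mD (measurable_kmul xi mf) (g := (fun x => `|f x|))).
  move=> x Dx; rewrite normc_kmul ler_piMl//.
  by rewrite -[leRHS](@expR0 R) ler_expR mulr_le0_ge0// D0.
have : mu.-integrable D (EFin \o f) by apply: integrableS f1.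
by move=> /integrable_abse; apply: eq_integrable_real.
Qed.

(** The cut is kept as a parameter because [Sop] discards the mass that it moves below 1: under
    scaling the lower end of integration changes together with the frequency. *)
Definition Lcut r xi f : R[i] := Cint `[r, +oo[ (kmul xi f).

Lemma FL_Lcut r xi f : (forall x, x < r -> f x = 0) -> FL f xi = Lcut r xi f.
Proof.
move=> f0; rewrite FLE /Lcut [RHS]Cint_mkcond; apply: eq_Cint => x _.
rewrite indicE mem_setE in_itv/= andbT.
case: leP => rx; first by rewrite mul1r.
by rewrite /kmul f0// !mulr0.
Qed.

Lemma Cint_affine (a c : R) (F : R -> R[i]) : 0 < a -> Cmeasurable setT F ->
  Cint setT F = Cint setT (fun x => a%:C * F (a * x + c)).
Proof.
move=> a0 [m1 m2]; rewrite /Cint; congr (_ +i* _).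
  rewrite (Rintegral_affine c a0 m1); apply: eq_Rintegral => x _.
  by rewrite Re_mulc/= mul0r subr0.
rewrite (Rintegral_affine c a0 m2); apply: eq_Rintegral => x _.
by rewrite Im_mulc/= mul0r addr0.
Qed.

(** Substitution u = e^s x. As [1 <= r], the truncation built into [Sop] is implied by the cut at
    [r]; the sign of [s] is arbitrary. *)
Lemma Lcut_Sop r s xi f : 1 <= r -> measurable_fun setT f ->
  Lcut r xi (Sop s f) = Lcut (r * expR s) ((expR (- s))%:C * xi) f.
Proof.
move=> r1 mf; rewrite /Lcut [LHS]Cint_mkcond [RHS]Cint_mkcond.
rewrite [RHS](Cint_affine 0 (expR_gt0 s)); last first.
  apply: CmeasurableM; last exact: measurable_kmul.
  exact: Cmeasurable_real.
apply: eq_Cint => x _; rewrite addr0 !indicE !mem_setE !in_itv/= !andbT.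
rewrite (mulrC r) ler_pM2l ?expR_gt0//; case: leP => rx; last by rewrite !mul0r mulr0.
rewrite !mul1r /kmul ker_scale (mulrA (expR (- s))) -expRD addNr expR0 mul1r.
by rewrite /Sop (le_trans r1 rx) rmorphM/= mulrCA.
Qed.

Lemma measurable_Sop s f : measurable_fun setT f -> measurable_fun setT (Sop s f).
Proof.
move=> mf; apply: measurable_fun_ifT;
  [by apply: measurable_fun_ler| |exact: measurable_cst].
apply: measurable_funM => //; apply: measurableT_comp mf _; exact: measurable_funM.
Qed.

Lemma measurable_T1op f : measurable_fun setT f -> measurable_fun setT (T1op f).
Proof.
move=> mf; apply: measurable_fun_ifT;
  [by apply: measurable_fun_ler| |exact: measurable_cst].
apply: measurableT_comp mf _; exact: measurable_funB.
Qed.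

Lemma FL_T1op xi f : measurable_fun setT f -> Cintegrable setT (kmul xi f) ->
  (forall x, x < 1 -> f x = 0) -> FL (T1op f) xi = ker xi 1 * FL f xi.
Proof.
move=> mf fi f0; rewrite !FLE.
rewrite (Cint_affine 1 ltr01 (measurable_kmul _ (measurable_T1op mf))).
rewrite -CintZ//; apply: eq_Cint => x _.
rewrite !mul1r /kmul addrC kerD mulrA /T1op lerD2l addrC addrK.
by case: leP => // x1; rewrite f0// !mulr0.
Qed.

End Transform.

(** * Convolutions *)

Section Convolution.
Context {R : realType}.
Local Notation mu := (@lebesgue_measure R).
Local Notation Rm := (measurableTypeR R).
Local Notation Re := (@complex.Re R).
Local Notation Im := (@complex.Im R).
Implicit Types (f g k : R -> R).

Lemma Rintegral_shift (c : R) f : measurable_fun setT f ->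
  \int[mu]_x f (x + c) = \int[mu]_x f x.
Proof.
move=> mf; rewrite [RHS](Rintegral_affine c ltr01 mf).
by apply: eq_Rintegral => x _; rewrite !mul1r.
Qed.

Section Weighted.
Variables (f g k : R -> R).
Hypotheses (if_ : L1 f) (ig : L1 g) (mk : measurable_fun setT k)
  (k1 : forall x, `|k x| <= 1).

Let H (z : Rm * Rm) : R := k z.1 * (f z.2 * g (z.1 - z.2)).

Let mH : measurable_fun setT H.
Proof.
have mf := L1_measurable if_; have mg := L1_measurable ig.
apply: measurable_funM; first exact: measurableT_comp.
apply: measurable_funM; first exact: measurableT_comp.
by apply: measurableT_comp => //; exact: measurable_funB.
Qed.

Let iH : (mu \x mu)%E.-integrable setT (EFin \o H).
Proof.
apply/integrable21ltyP; first exact/measurable_EFinP.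
have mf := L1_measurable if_; have mg := L1_measurable ig.
have [_ fi] := integrableP _ _ _ if_; have [_ gi] := integrableP _ _ _ ig.
have gs y : (\int[mu]_x `|(g (x - y))%:E| = \int[mu]_x `|(g x)%:E|)%E.
  rewrite [RHS](ge0_integral_affine (- y) ltr01)//.
    by apply: eq_integral => x _; rewrite mul1e mul1r.
  by do 2 apply: measurableT_comp => //.
have mgs y : measurable_fun setT (fun x : R => g (x - y)).
  by apply: measurableT_comp => //; exact: measurable_funB.
have mHy y : measurable_fun setT (fun x : R => k x * (f y * g (x - y))).
  apply: (measurable_funM mk); apply: (measurable_funM _ (mgs y)).
  exact: measurable_cst.
apply: (@le_lt_trans _ _ (\int[mu]_y (`|(f y)%:E| * \int[mu]_x `|(g x)%:E|))%E).
  apply: ge0_le_integral => //.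
  - by move=> y _; exact: integral_ge0.
  - apply: (measurable_fun_fubini_tonelli_G (abse \o (EFin \o H))) => //=.
    by apply: measurableT_comp => //; exact/measurable_EFinP.
  - apply: emeasurable_funM; last exact: measurable_cst.
    by apply/measurable_EFinP/measurableT_comp.
  - move=> y _; rewrite -(gs y) -ge0_integralZl//; last first.
      by do 2 apply: measurableT_comp => //; exact: mgs.
    apply: ge0_le_integral => //.
    + by apply: measurableT_comp => //; apply/measurable_EFinP; exact: mHy.
    + apply: emeasurable_funM; first exact: measurable_cst.
      by do 2 apply: measurableT_comp => //; exact: mgs.
    + by move=> x _; rewrite /H /= lee_fin !normrM ler_piMl// mulr_ge0.
rewrite ge0_integralZr//.
- by rewrite lte_mul_pinfty// ?integral_ge0// ge0_fin_numE// integral_ge0.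
- by apply: measurableT_comp => //; exact/measurable_EFinP.
- exact: integral_ge0.
Qed.

(** By Tonelli and [|k| <= 1] the integral of the modulus is at most the product of the two L^1
    norms. The weight lets one statement serve both the convolution itself ([k = 1]) and its
    transform ([k] a real or imaginary part of the kernel). *)
Lemma integrable_conv_prod : (mu \x mu)%E.-integrable setT
  (EFin \o (fun z : Rm * Rm => k z.1 * (f z.2 * g (z.1 - z.2)))).
Proof. exact: iH. Qed.

End Weighted.

Lemma measurable_conv f g : L1 f -> L1 g -> measurable_fun setT (Defs.conv f g).
Proof.
move=> if_ ig.
have i1 := @integrable_conv_prod f g (cst 1) if_ ig
  (measurable_cst _) (fun=> eq_ind_r (fun y => y <= 1) (lexx 1) (normr1 R)).
have mF := measurable_fubini_F i1.
rewrite (_ : Defs.conv f g = fine \o fubini_F mu (EFin \o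
    (fun z : Rm * Rm => cst 1 z.1 * (f z.2 * g (z.1 - z.2))))).
  exact: measurableT_comp.
apply/funext => x; rewrite /Defs.conv /fubini_F /=; congr fine.
by apply: eq_integral => y _ /=; rewrite mul1r.
Qed.

Section Weighted2.
Variables (f g k : R -> R).
Hypotheses (if_ : L1 f) (ig : L1 g) (mk : measurable_fun setT k)
  (k1 : forall x, `|k x| <= 1).

Let iH := integrable_conv_prod if_ ig mk k1.

Let convE : {ae mu, forall x,
  \int[mu]_y (k x * (f y * g (x - y)))%:E = (k x * Defs.conv f g x)%:E}%E.
Proof.
have := ae_integrable1 iH; apply: ae_imply => x iHx.
(* Fubini gives integrability of the weighted section only. Dividing by [k x] removes the weight;
   where [k x = 0] both sides vanish. *)
have [k0|k0] := eqVneq (k x) 0.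
  rewrite k0 mul0r; under eq_integral do rewrite mul0r.
  by rewrite integral0.
have ifg : mu.-integrable setT (EFin \o (fun y => f y * g (x - y))).
  have := integrableZl_real (k x)^-1 measurableT iHx.
  by apply: eq_integrable_real => // y _ /=; rewrite mulKf.
rewrite /Defs.conv -RintegralZl// fineK//.
apply: integrable_fin_num => //.
Qed.

Lemma integrable_conv_weight : mu.-integrable setT (EFin \o (fun x => k x * Defs.conv f g x)).
Proof.
have mc := measurable_conv if_ ig.
have /integrableP[mF iF] := integrable_fubini_F iH.
apply/integrableP; split; first exact/measurable_EFinP/measurable_funM.
move: iF; congr (_ < _)%E; apply: ae_eq_integral => //.
- exact: measurableT_comp.
- apply: measurableT_comp => //; exact/measurable_EFinP/measurable_funM.
- by apply: ae_imply convE => x Ex _; congr (`|_|)%E; first [exact: Ex|exact: (esym Ex)].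
Qed.

Lemma Rintegral_conv_weight :
  \int[mu]_x (k x * Defs.conv f g x) =
  \int[mu]_y (f y * \int[mu]_u (k (u + y) * g u)).
Proof.
have mf := L1_measurable if_; have mg := L1_measurable ig.
have mc := measurable_conv if_ ig.
transitivity (fine (\int[mu]_x \int[mu]_y (k x * (f y * g (x - y)))%:E)%E).
  congr fine; apply: ae_eq_integral => //.
  - exact/measurable_EFinP/measurable_funM.
  - exact: measurable_fubini_F iH.
  - by apply: ae_imply convE => x Ex _; first [exact: Ex|exact: (esym Ex)].
rewrite (Fubini iH); congr fine; apply: eq_integral => y _.
rewrite /=.
have mgs : measurable_fun setT (fun x : R => k x * g (x - y)).
  apply: (measurable_funM mk).
  by apply: measurableT_comp => //; exact: measurable_funB.
have gsi : mu.-integrable setT (EFin \o (fun x => k x * g (x - y))).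
  have : mu.-integrable setT (EFin \o (fun x => g (x - y))).
    have := integrable_affine (- y) ltr01 ig; apply: eq_integrable_real => //.
    by move=> x _; rewrite !mul1r.
  move=> /integrable_abse; apply: le_integrable_real => // x _.
  by rewrite normrM ler_piMl.
have -> : \int[mu]_u (k (u + y) * g u) = \int[mu]_u (k u * g (u - y)).
  by rewrite -(Rintegral_shift y mgs); apply: eq_Rintegral => u _; rewrite addrK.
rewrite -RintegralZl// fineK//; last first.
  by apply: integrable_fin_num => //; exact: integrableZl_real.
by apply: eq_integral => x _; rewrite mulrCA.
Qed.

End Weighted2.
End Convolution.

Section TransformConvolution.
Context {R : realType}.
Local Notation mu := (@lebesgue_measure R).
Local Notation Rm := (measurableTypeR R).
Local Notation Re := (@complex.Re R).
Local Notation Im := (@complex.Im R).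
Implicit Types (f g k : R -> R) (xi : R[i]).

Lemma Re_mulr (z : R[i]) (r : R) : Re (z * r%:C) = Re z * r.
Proof. by rewrite Re_mulc /= mulr0 subr0. Qed.

Lemma Im_mulr (z : R[i]) (r : R) : Im (z * r%:C) = Im z * r.
Proof. by rewrite Im_mulc /= mulr0 add0r. Qed.

Definition null_below1 f := forall x, x < 1 -> f x = 0.

Lemma L1_conv f g : L1 f -> L1 g -> L1 (Defs.conv f g).
Proof.
move=> if_ ig.
have := integrable_conv_weight if_ ig (measurable_cst (1 : R))
  (fun=> eq_ind_r (fun y => y <= 1) (lexx 1) (normr1 R)).
by apply: eq_integrable_real => // x _; rewrite mul1r.
Qed.

Lemma null_below1_conv f g : null_below1 f -> null_below1 g ->
  null_below1 (Defs.conv f g).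
Proof.
move=> f0 g0 x x1; rewrite /Defs.conv.
rewrite (@eq_Rintegral _ _ _ mu setT (fun=> 0)) ?Rintegral_cst ?mul0r// => y _.
have [y1|y1] := ltP y 1; first by rewrite f0// mul0r.
by rewrite g0 ?mulr0//; lra.
Qed.

Lemma integrable_kmulT xi f : Im xi <= 0 -> L1 f -> null_below1 f ->
  Cintegrable setT (kmul xi f).
Proof.
move=> xi0 f1 f0; have mf := L1_measurable f1.
apply: (le_Cintegrable _ (measurable_kmul xi mf) (g := (fun x => `|f x|))) => //.
  move=> x _; rewrite normc_kmul; have [x1|x1] := ltP x 1.
    by rewrite f0// normr0 mulr0.
  by rewrite ler_piMl// -[leRHS](@expR0 R) ler_expR mulr_le0_ge0// (le_trans _ x1).
by move: f1 => /integrable_abse; apply: eq_integrable_real.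
Qed.

Lemma FL_conv xi f g : Im xi <= 0 -> L1 f -> L1 g -> null_below1 f -> null_below1 g ->
  FL (Defs.conv f g) xi = FL f xi * FL g xi.
Proof.
move=> xi0 if_ ig f0 g0.
have mf := L1_measurable if_; have mg := L1_measurable ig.
(* The kernel is unbounded on the negative half-line when [Im xi < 0]. Cutting it at 0 makes it a
   weight bounded by 1 and changes nothing for functions that vanish below 1. *)
pose kr (x : R) : R := \1_`[0, +oo[ x * Re (ker xi x).
pose ki (x : R) : R := \1_`[0, +oo[ x * Im (ker xi x).
have [mR mI] := measurable_ker setT xi.
have mkr : measurable_fun setT kr by apply: measurable_funM.
have mki : measurable_fun setT ki by apply: measurable_funM.
have kb x : 0 <= x -> Normc.normc (ker xi x) <= 1 by exact: normc_ker_le1.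
have ind0 (x : R) : \1_`[0, +oo[ x = ((0 <= x)%R)%:R :> R.
  by rewrite indicE mem_setE in_itv/= andbT.
have kr1 x : `|kr x| <= 1.
  rewrite /kr ind0; case: (leP 0 x) => x0.
    by rewrite mul1r (le_trans (Re_le_normc _))// kb.
  by rewrite mul0r normr0.
have ki1 x : `|ki x| <= 1.
  rewrite /ki ind0; case: (leP 0 x) => x0.
    by rewrite mul1r (le_trans (Im_le_normc _))// kb.
  by rewrite mul0r normr0.
have krE x : 0 <= x -> kr x = Re (ker xi x).
  by move=> x0; rewrite /kr ind0 x0 mul1r.
have kiE x : 0 <= x -> ki x = Im (ker xi x).
  by move=> x0; rewrite /ki ind0 x0 mul1r.
have c0 := null_below1_conv f0 g0.
have redR h : null_below1 h -> Re (FL h xi) = \int[mu]_x (kr x * h x).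
  move=> h0; transitivity (\int[mu]_x Re (kmul xi h x)); first by [].
  apply: eq_Rintegral => x _.
  rewrite /kmul Re_mulr.
  have [x1|x1] := ltP x 1; first by rewrite h0// !mulr0.
  by rewrite krE ?(le_trans _ x1).
have redI h : null_below1 h -> Im (FL h xi) = \int[mu]_x (ki x * h x).
  move=> h0; transitivity (\int[mu]_x Im (kmul xi h x)); first by [].
  apply: eq_Rintegral => x _.
  rewrite /kmul Im_mulr.
  have [x1|x1] := ltP x 1; first by rewrite h0// !mulr0.
  by rewrite kiE ?(le_trans _ x1).
have bi k h : measurable_fun setT k -> (forall x, `|k x| <= 1) -> L1 h ->
    mu.-integrable setT (EFin \o (fun x => k x * h x)).
  move=> mk k1 ih; have mh := L1_measurable ih.
  move: ih => /integrable_abse; apply: le_integrable_real => //.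
    exact: measurable_funM.
  by move=> x _; rewrite normrM ler_piMl.
have bikr h : L1 h -> mu.-integrable setT (EFin \o (fun x => kr x * h x)) by exact: bi.
have biki h : L1 h -> mu.-integrable setT (EFin \o (fun x => ki x * h x)) by exact: bi.
have Zl c h : mu.-integrable setT (EFin \o h) ->
    mu.-integrable setT (EFin \o (fun x => c * h x)) by exact: integrableZl_real.
set A := \int[mu]_x (kr x * g x); set B := \int[mu]_x (ki x * g x).
(* The inner integrals of the Fubini formula factor by the addition rule [kerD], written in real and
   imaginary parts. *)
have innerR y : 1 <= y -> \int[mu]_u (kr (u + y) * g u) = kr y * A - ki y * B.
  move=> y1; have y0 : 0 <= y by rewrite (le_trans _ y1).
  rewrite -!RintegralZl ?bikr ?biki// -RintegralB ?Zl ?bikr ?biki//.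
  apply: eq_Rintegral => u _; have [u1|u1] := ltP u 1.
    by rewrite g0// !mulr0 subr0.
  have u0 : 0 <= u by rewrite (le_trans _ u1).
  by rewrite !krE ?kiE ?addr_ge0// kerD Re_mulc; ring.
have innerI y : 1 <= y -> \int[mu]_u (ki (u + y) * g u) = ki y * A + kr y * B.
  move=> y1; have y0 : 0 <= y by rewrite (le_trans _ y1).
  rewrite -!RintegralZl ?bikr ?biki// -RintegralD ?Zl ?bikr ?biki//.
  apply: eq_Rintegral => u _; have [u1|u1] := ltP u 1.
    by rewrite g0// !mulr0 addr0.
  have u0 : 0 <= u by rewrite (le_trans _ u1).
  by rewrite krE ?kiE ?krE ?addr_ge0// kerD Im_mulc; ring.
apply: complex_eq; rewrite ?Re_mulc ?Im_mulc ?redR ?redI// -/A -/B.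
  rewrite Rintegral_conv_weight// !(mulrC _ A) !(mulrC _ B).
  rewrite -!RintegralZl ?bikr ?biki// -RintegralB ?Zl ?bikr ?biki//.
  apply: eq_Rintegral => y _; have [y1|y1] := ltP y 1.
    by rewrite f0// !(mul0r, mulr0) subr0.
  by rewrite innerR//; ring.
rewrite Rintegral_conv_weight// !(mulrC _ A) !(mulrC _ B).
rewrite -!RintegralZl ?bikr ?biki// -RintegralD ?Zl ?bikr ?biki//.
apply: eq_Rintegral => y _; have [y1|y1] := ltP y 1.
  by rewrite f0// !(mul0r, mulr0) addr0.
by rewrite innerI//; ring.
Qed.

Lemma conv_powP f j : L1 f -> null_below1 f ->
  L1 (conv_pow f j) /\ null_below1 (conv_pow f j).
Proof.
move=> f1 f0; rewrite /conv_pow; elim: j.-1 => [|n [IH1 IH0]]//=.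
by split; [exact: L1_conv|exact: null_below1_conv].
Qed.

Lemma FL_conv_pow xi f j : Im xi <= 0 -> L1 f -> null_below1 f -> (0 < j)%N ->
  FL (conv_pow f j) xi = FL f xi ^+ j.
Proof.
move=> xi0 f1 f0; case: j => // j _; elim: j => [|j IH]; first by rewrite expr1.
have [c1 c0] := conv_powP j.+1 f1 f0.
by rewrite exprS -IH [conv_pow _ _]/= FL_conv.
Qed.

Lemma L1_Qop p N f : L1 f -> null_below1 f -> L1 (Qop p N f).
Proof.
move=> f1 f0; rewrite /Qop.
elim: (index_iota 1 N.+1) => [|j s IH].
  by apply: (eq_integrable_real _ _ (integrable0 _ _)) => // x _; rewrite big_nil.
have [c1 _] := conv_powP j f1 f0.
have := integrableD_real measurableT (integrableZl_real (p j) measurableT c1) IH.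
by apply: eq_integrable_real => // x _; rewrite big_cons.
Qed.

Lemma null_below1_Qop p N f : null_below1 f -> null_below1 (Qop p N f).
Proof.
move=> f0 x x1; rewrite /Qop big1// => j _.
suff -> : conv_pow f j x = 0 by rewrite mulr0.
rewrite /conv_pow; elim: j.-1 x x1 => [|n IH] x x1 /=; first exact: f0.
exact: (null_below1_conv f0 IH).
Qed.

Lemma FL_Qop p N xi f : Im xi <= 0 -> L1 f -> null_below1 f ->
  FL (Qop p N f) xi = Qpoly p N (FL f xi).
Proof.
move=> xi0 f1 f0; rewrite /Qop /Qpoly.
(* Positivity of the exponents must be carried through the induction: [conv_pow f 0] is [f], whose
   transform is not the zeroth power. *)
have : all (fun j => 0 < j)%N (index_iota 1 N.+1).
  by apply/allP => j; rewrite mem_index_iota => /andP[].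
suff H s : all (fun j => 0 < j)%N s ->
    Cintegrable setT (kmul xi (fun x => \sum_(j <- s) p j * conv_pow f j x)) /\
    FL (fun x => \sum_(j <- s) p j * conv_pow f j x) xi =
    \sum_(j <- s) (p j)%:C * FL f xi ^+ j by move=> /H[].
elim: s => [_|j s IH /= /andP[j0 /IH[IH1 IH2]]].
  have E x : kmul xi (fun x => \sum_(j <- [::]) p j * conv_pow f j x) x = 0.
    by rewrite /kmul big_nil rmorph0 mulr0.
  have z : Cintegrable [set: R] (fun=> 0) by split; exact: integrable0.
  split; first by have := z; apply: eq_Cintegrable => // x _; rewrite E.
  rewrite big_nil FLE -(mul0r (Cint [set: R] (fun=> 0))) -CintZ//.
  by apply: eq_Cint => x _; rewrite E mul0r.
have [c1 c0] := conv_powP j f1 f0.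
have ic := integrable_kmulT xi0 c1 c0.
have E : {in setT, (fun x => (p j)%:C * kmul xi (conv_pow f j) x +
    kmul xi (fun x => \sum_(i <- s) p i * conv_pow f i x) x) =1
    kmul xi (fun x => \sum_(i <- j :: s) p i * conv_pow f i x)}.
  by move=> x _; rewrite /kmul big_cons rmorphD/= rmorphM/=; ring.
split.
  apply: (eq_Cintegrable _ E) => //; apply: CintegrableD => //.
  exact: CintegrableZ.
rewrite FLE -(eq_Cint E) CintD//; last exact: CintegrableZ.
by rewrite CintZ// -!FLE FL_conv_pow// IH2 big_cons.
Qed.

End TransformConvolution.

(** * Uniqueness for the Laplace transform *)

Section Laplace.
Context {R : realType}.
Local Notation mu := (@lebesgue_measure R).
Local Notation Rm := (measurableTypeR R).

Lemma Rintegral_dominated (f_ : nat -> R -> R) (f g : R -> R) :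
  (forall n, measurable_fun setT (f_ n)) -> measurable_fun setT f ->
  {ae mu, forall x, f_ n x @[n --> \oo] --> f x} ->
  mu.-integrable setT (EFin \o g) -> (forall n x, `|f_ n x| <= g x) ->
  \int[mu]_x f_ n x @[n --> \oo] --> \int[mu]_x f x.
Proof.
move=> mf_ mf f_f ig fg.
have mfE n : measurable_fun setT (EFin \o f_ n) by exact/measurable_EFinP.
have mfE' : measurable_fun setT (EFin \o f) by exact/measurable_EFinP.
have cE : {ae mu, forall x, setT x -> (EFin \o f_ n) x @[n --> \oo] --> (EFin \o f) x}.
  by apply: ae_imply f_f => x h _; apply/cvg_EFin => //; exact: nearW.
have dE : {ae mu, forall x n, setT x -> (`|(EFin \o f_ n) x| <= (EFin \o g) x)%E}.
  by apply/aeW => x n _ /=; rewrite lee_fin fg.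
have [i1 _] := @dominated_convergence _ Rm R mu setT measurableT
  (fun n => EFin \o f_ n) (EFin \o f) (EFin \o g) mfE mfE' cE ig dE.
move: (integrable_fin_num measurableT i1) => fi.
by rewrite -[X in _ --> X](fineK fi) => /fine_cvgP[_].
Qed.

(** Expand exp(-T) and integrate term by term, with e^B |h| as dominating function since [T] lies in
    [0, B] where [h] is nonzero. The term of index 0 is the integral of [h]; the moment bounds turn
    the others into the series of M (e^s - 1). *)
Lemma expR_poly_moments (T h : R -> R) (B M s : R) :
  measurable_fun setT T -> mu.-integrable setT (EFin \o h) ->
  (forall x, h x != 0 -> 0 <= T x <= B) -> 0 <= s -> 0 <= M ->
  (forall k, (0 < k)%N -> `|\int[mu]_x (T x ^+ k * h x)| <= M * s ^+ k) ->
  `|\int[mu]_x (expR (- T x) * h x) - \int[mu]_x h x| <= M * (expR s - 1).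
Proof.
move=> mT ih TB s0 M0 mom.
have mh : measurable_fun setT h by case/integrableP : ih => /measurable_EFinP.
pose P K x := \sum_(0 <= k < K) exp_coeff (- T x) k * h x.
have mP K : measurable_fun setT (P K).
  apply: measurable_sum => k; apply: measurable_funM => //.
  rewrite /exp_coeff/=; apply: measurable_funM => //; apply: measurable_funX.
  exact: measurableT_comp.
have iT k : mu.-integrable setT (EFin \o (fun x => T x ^+ k * h x)).
  have : mu.-integrable setT (EFin \o (fun x => B ^+ k * `|h x|)).
    by apply: integrableZl_real => //; move: ih => /integrable_abse; apply: eq_integrable_real.
  apply: le_integrable_real => //.
    by apply: measurable_funM => //; exact: measurable_funX.
  move=> x _; have [->|hx] := eqVneq (h x) 0; first by rewrite mulr0 !normr0 mulr0.
  have /andP[T0 TB'] := TB x hx.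
  by rewrite normrM ler_wpM2r// normrX ger0_norm// lerXn2r ?nnegrE// (le_trans T0).
have ecE k x : exp_coeff (- T x) k * h x = (-1) ^+ k / k`!%:R * (T x ^+ k * h x).
  by rewrite /exp_coeff/= [in LHS](exprNn (T x)); ring.
have iTk k : mu.-integrable setT (EFin \o (fun x => exp_coeff (- T x) k * h x)).
  have := integrableZl_real ((-1) ^+ k / k`!%:R) measurableT (iT k).
  by apply: eq_integrable_real => // x _; rewrite ecE.
have iP K : mu.-integrable setT (EFin \o P K) /\
    \int[mu]_x P K x = \sum_(0 <= k < K) \int[mu]_x (exp_coeff (- T x) k * h x).
  elim: K => [|K [IH1 IH2]].
    have E x : P 0%N x = 0 by rewrite /P big_geq.
    have i0 : mu.-integrable setT (EFin \o (fun=> 0 : R)) by exact: integrable0.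
    split; first by move: i0; apply: eq_integrable_real => // x _; rewrite E.
    rewrite big_geq// (@eq_Rintegral _ _ _ mu setT (fun=> 0)) ?Rintegral_cst ?mul0r//.
  have E x : P K x + exp_coeff (- T x) K * h x = P K.+1 x.
    by rewrite /P big_nat_recr.
  split.
    have := integrableD_real measurableT IH1 (iTk K).
    by apply: eq_integrable_real => // x _; rewrite E.
  rewrite big_nat_recr//= -IH2 -RintegralD//.
  by apply: eq_Rintegral => x _; rewrite -E.
have cP : \int[mu]_x P K x @[K --> \oo] --> \int[mu]_x (expR (- T x) * h x).
  apply: (@Rintegral_dominated _ _ (fun x => expR B * `|h x|)) => //.
  - apply: measurable_funM => //.
    by apply: measurableT_comp; [exact: measurable_expR|exact: measurableT_comp].
  - apply/aeW => x.
    rewrite (_ : P ^~ x = (fun K => series (exp_coeff (- T x)) K * h x)); last first.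
      by apply/funext => K; rewrite /P /series/= mulr_suml.
    by apply: cvgMl; exact: is_cvg_series_exp_coeff.
  - by apply: integrableZl_real => //; move: ih => /integrable_abse; apply: eq_integrable_real.
  - move=> K x; rewrite /P -mulr_suml normrM.
    have [->|hx] := eqVneq (h x) 0; first by rewrite normr0 !mulr0.
    have /andP[T0 TB'] := TB x hx.
    rewrite ler_wpM2r// (le_trans (ler_norm_sum _ _ _))//.
    apply: (@le_trans _ _ (expR (T x))); last by rewrite ler_expR.
    apply: (@le_trans _ _ (series (exp_coeff (T x)) K)).
      rewrite /series/=; apply: ler_sum => k _.
      by rewrite normrM normfV normr_nat normrX normrN ger0_norm.
    apply: nondecreasing_cvgn_le; last exact: is_cvg_series_exp_coeff.
    by apply: nondecreasing_series => k _ _; exact: exp_coeff_ge0.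
have bP K : `|\int[mu]_x P K.+1 x - \int[mu]_x h x| <= M * (expR s - 1).
  rewrite (iP K.+1).2 big_nat_recl//= .
  have e0 x : exp_coeff (- T x) 0 * h x = h x by rewrite /exp_coeff/= expr0 fact0 divr1 mul1r.
  under eq_Rintegral do rewrite e0.
  rewrite addrAC subrr add0r.
  apply: (@le_trans _ _ (\sum_(0 <= k < K) M * exp_coeff s k.+1)).
    rewrite (le_trans (ler_norm_sum _ _ _))//; apply: ler_sum => k _.
    have -> : \int[mu]_x (exp_coeff (- T x) k.+1 * h x) =
        (-1) ^+ k.+1 / k.+1`!%:R * \int[mu]_x (T x ^+ k.+1 * h x).
      by rewrite -RintegralZl//; apply: eq_Rintegral => x _; rewrite ecE.
    rewrite normrM normrM normrX normrN1 expr1n mul1r normfV normr_nat.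
    by rewrite /exp_coeff/= mulrA mulrC ler_wpM2r ?invr_ge0// mom.
  rewrite -mulr_sumr ler_wpM2l//.
  rewrite lerBrDl.
  apply: (@le_trans _ _ (series (exp_coeff s) K.+1)).
    by rewrite /series/= big_nat_recl// /exp_coeff/= expr0 fact0 divr1.
  apply: nondecreasing_cvgn_le; last exact: is_cvg_series_exp_coeff.
  by apply: nondecreasing_series => k _ _; exact: exp_coeff_ge0.
have : `|\int[mu]_x P K.+1 x - \int[mu]_x h x| @[K --> \oo] -->
    `|\int[mu]_x (expR (- T x) * h x) - \int[mu]_x h x|.
  apply: cvg_norm; apply: cvgB; last exact: cvg_cst.
  by rewrite (cvg_shiftS (fun K => \int[mu]_x P K x)).
move=> cv; rewrite -(cvg_lim (@Rhausdorff R) cv); apply: limr_le.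
  by apply/cvg_ex; eexists; exact: cv.
by apply: nearW => K; exact: bP.
Qed.
End Laplace.

Section LaplaceVanish.
Context {R : realType}.
Local Notation mu := (@lebesgue_measure R).
Local Notation Rm := (measurableTypeR R).

Lemma cvg_mulrn_expR0 (c : R) : c < 0 -> expR (n%:R * c) @[n --> \oo] --> 0.
Proof.
move=> c0; have c1 : 0 < - c by rewrite oppr_gt0.
have cm : (r * (- c)) @[r --> +oo] --> +oo by apply: (gt0_cvgMly c1); exact: cvg_id.
rewrite (_ : (fun n => _) =
    ((fun x : R => expR (- x)) \o (fun r : R => r * (- c))) \o (fun n => n%:R)).
  apply: (cvg_comp _ _ (@cvgr_idn R)); exact: (cvg_comp _ _ cm (@cvgr_expR R)).
by apply/funext => n /=; rewrite mulrN opprK.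
Qed.

Lemma cvg_double_exp (b : R) (x : R) : x != b ->
  expR (- expR (n%:R * (b - x))) @[n --> \oo] --> (\1_(`]b, +oo[) x : R).
Proof.
move=> xb; rewrite indicE mem_setE in_itv/= andbT; have [bx|bx] := ltP b x.
  have c0 : b - x < 0 by rewrite subr_lt0.
  have cv : - expR (n%:R * (b - x)) @[n --> \oo] --> (0 : R).
    by rewrite -[X in _ --> X]oppr0; exact: (cvgN (cvg_mulrn_expR0 c0)).
  rewrite [X in _ --> X](_ : _ = expR 0); last by rewrite expR0.
  exact: (continuous_cvg _ (@continuous_expR R 0) cv).
have bx0 : 0 < b - x by rewrite subr_gt0 lt_neqAle xb.
(* From e^y >= 1 + y with y = n (b - x), the double exponential is at most e^(-y). *)
apply: (@squeeze_cvgr _ _ _ _ (fun=> 0) (fun n => expR (n%:R * (x - b)))).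
- apply: nearW => n; rewrite expR_ge0/= ler_expR -(opprB b x) mulrN lerN2.
  by rewrite (le_trans _ (expR_ge1Dx _))// lerDr.
- exact: cvg_cst.
- by apply: cvg_mulrn_expR0; rewrite subr_lt0 lt_neqAle xb.
Qed.

Lemma cvg_Rintegral_double_exp (b : R) (h : R -> R) :
  mu.-integrable setT (EFin \o h) ->
  \int[mu]_x (expR (- expR (n%:R * (b - x))) * h x) @[n --> \oo] -->
  \int[mu]_x (\1_(`]b, +oo[) x * h x).
Proof.
move=> ih; have mh : measurable_fun setT h by case/integrableP : ih => /measurable_EFinP.
apply: (@Rintegral_dominated _ _ _ (fun x => `|h x|)).
- move=> n; apply: measurable_funM => //; apply: measurableT_comp; first exact: measurable_expR.
  apply: measurableT_comp => //; apply: measurableT_comp; first exact: measurable_expR.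
  by apply: measurable_funM => //; exact: measurable_funB.
- by apply: measurable_funM.
- have : {ae mu, forall x, x != b}.
    exists [set b]; split => //=; first exact: lebesgue_measure_set1.
    by move=> x /= /negP; rewrite negbK => /eqP.
  apply: ae_imply => x xb; apply: cvgMl; exact: cvg_double_exp.
- by move: ih => /integrable_abse; apply: eq_integrable_real.
- move=> n x; rewrite normrM ger0_norm ?expR_ge0// ler_piMl//.
Qed.

(** Almost everywhere [h] is the derivative of its primitive, and the primitive is locally constant
    to the left of [a]. *)
Lemma integral_primitive_ae0 (h : R -> R) (a : R) : mu.-integrable setT (EFin \o h) ->
  (forall b, b < a -> \int[mu]_(x in `]-oo, b]) h x = 0) ->
  {ae mu, forall x, x < a -> h x = 0}.
Proof.
move=> ih h0.
have ih' y : mu.-integrable `]-oo, y] (EFin \o h) by apply: integrableS ih.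
have lh : locally_integrable [set: R] h by apply: open_integrable_locally => //; exact: openT.
have := FTC1Ny ih' lh; apply: ae_imply => x [dF] <- xa.
rewrite derive1E.
rewrite (@near_eq_derive _ _ _ _ (fun=> 0)) ?derive_cst//.
near=> z; rewrite h0//; near: z.
exact: lt_nbhsl.
Unshelve. all: by end_near. Qed.

(* Mikusinski's proof of the uniqueness theorem: expanding the exponential, the
   growth of the moments forces int (1 - exp (- e^(n (b - x)))) h(x) dx -> 0,
   and the limit of the left-hand side is the integral of h over (-oo, b]. *)
Lemma laplace_vanish (d : R -> R) (a C : R) : measurable_fun setT d ->
  (forall x, x < 0 -> d x = 0) ->
  mu.-integrable setT (EFin \o (fun x => expR (- x) * d x)) ->
  (forall n, (0 < n)%N ->
    mu.-integrable setT (EFin \o (fun x => expR (- n%:R * x) * d x)) /\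
    `|\int[mu]_x (expR (- n%:R * x) * d x)| <= C * expR (- n%:R * a)) ->
  {ae mu, forall x, x < a -> d x = 0}.
Proof.
move=> md d0 id hC.
pose h x := \1_(`]-oo, a[) x * d x.
have i1 (x : R) : \1_(`]-oo, a[) x = ((x < a)%R)%:R :> R.
  by rewrite indicE mem_setE in_itv.
have mh : measurable_fun setT h by apply: measurable_funM.
have hb (x : R) : `|h x| <= expR a * `|expR (- x) * d x|.
  rewrite /h i1; case: (ltP x a) => xa; last first.
    by rewrite mul0r normr0 mulr_ge0// expR_ge0.
  rewrite mul1r normrM ger0_norm ?expR_ge0// mulrA -expRD ler_peMl//.
  by rewrite -[leLHS](@expR0 R) ler_expR subr_ge0 ltW.
have iabs : mu.-integrable setT (EFin \o (fun x => `|expR (- x) * d x|)).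
  by move: id => /integrable_abse; apply: eq_integrable_real.
have ih : mu.-integrable setT (EFin \o h).
  by apply: (le_integrable_real _ _ (g := (fun x => expR a * `|expR (- x) * d x|))) => //;
    exact: integrableZl_real.
(* A bound on the moments of the part of [d] below [a], uniform in the frequency. [C] accounts for
   the full transform multiplied by e^(n a), the second term for the tail, where e^(n (a - x)) <=
   e^(a - x) because [1 <= n] and [a <= x]. *)
set M := C + expR a * \int[mu]_x `|expR (- x) * d x|.
have Mb n : (0 < n)%N -> `|\int[mu]_x (expR (n%:R * (a - x)) * h x)| <= M.
  move=> n0; have [inn Cn] := hC n n0.
  pose t x := \1_(`[a, +oo[) x * (expR (n%:R * (a - x)) * d x).
  have i2 (x : R) : \1_(`[a, +oo[) x = ((a <= x)%R)%:R :> R.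
    by rewrite indicE mem_setE in_itv/= andbT.
  have mt : measurable_fun setT t.
    apply: measurable_funM => //; apply: measurable_funM => //.
    apply: measurableT_comp; first exact: measurable_expR.
    by apply: measurable_funM => //; exact: measurable_funB.
  have tb (x : R) : `|t x| <= expR a * `|expR (- x) * d x|.
    rewrite /t i2; case: (leP a x) => ax; last first.
      by rewrite mul0r normr0 mulr_ge0// expR_ge0.
    rewrite mul1r !normrM !(ger0_norm (expR_ge0 _)) mulrA -expRD ler_wpM2r// ler_expR.
    by rewrite -[leRHS]mul1r ler_wnM2r ?ler1n// subr_le0.
  have it : mu.-integrable setT (EFin \o t).
    by apply: (le_integrable_real _ _ (g := (fun x => expR a * `|expR (- x) * d x|))) => //;
      exact: integrableZl_real.
  have E (x : R) : expR (n%:R * (a - x)) * h x =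
      expR (n%:R * a) * (expR (- n%:R * x) * d x) - t x.
    rewrite /h /t i1 i2 mulrBr expRD mulNr mulrA.
    by case: (ltP x a) => xa; rewrite ?(mul0r, mulr0, mul1r, subr0, subrr).
  under eq_Rintegral do rewrite E.
  rewrite RintegralB//; last exact: integrableZl_real.
  rewrite RintegralZl// (le_trans (ler_normB _ _))// lerD//.
    rewrite normrM ger0_norm ?expR_ge0//.
    rewrite (le_trans (ler_wpM2l (expR_ge0 _) Cn))// mulrCA -expRD mulNr subrr.
    by rewrite expR0 mulr1.
  rewrite -RintegralZl// (le_trans (le_normr_Rintegral _ _))//.
  apply: le_Rintegral => //; last exact: integrableZl_real.
  by move: it => /integrable_abse; apply: eq_integrable_real.
have iem m : mu.-integrable setT (EFin \o (fun x => expR (m%:R * (a - x)) * h x)).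
  have : mu.-integrable setT (EFin \o (fun x => expR (m%:R * a) * `|h x|)).
    by apply: integrableZl_real => //; move: ih => /integrable_abse; apply: eq_integrable_real.
  apply: le_integrable_real => //.
    apply: measurable_funM => //; apply: measurableT_comp; first exact: measurable_expR.
    by apply: measurable_funM => //; exact: measurable_funB.
  move=> x _; rewrite normrM (ger0_norm (expR_ge0 _)).
  have [x0|x0] := ltP x 0; first by rewrite /h d0// !(mulr0, normr0).
  by rewrite ler_wpM2r// ler_expR ler_wpM2l// lerBlDr lerDl.
have M0 : 0 <= M by apply: le_trans (Mb 1%N isT).
have hI b : b < a -> \int[mu]_(x in `]-oo, b]) h x = 0.
  move=> ba.
  have c1 := cvg_Rintegral_double_exp (b := b) ih.
  have c2 : M * (expR (expR (n%:R * (b - a))) - 1) @[n --> \oo] --> 0.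
    have c0 := cvg_mulrn_expR0 (_ : b - a < 0).
    have cv := continuous_cvg _ (@continuous_expR R 0) (c0 _).
    have -> : 0 = M * (expR 0 - 1) by rewrite expR0 subrr mulr0.
    by apply: cvgMr; apply: cvgB; [apply: cv; rewrite subr_lt0|exact: cvg_cst].
  have key n : (0 < n)%N -> `|\int[mu]_x (expR (- expR (n%:R * (b - x))) * h x)
      - \int[mu]_x h x| <= M * (expR (expR (n%:R * (b - a))) - 1).
    move=> n0.
    (* The value of [B] uses that [h] vanishes for [x < 0]. The parameter [s] becomes e^(n (b - a)),
       which tends to 0 because [b < a]. *)
    apply: (expR_poly_moments (T := fun x => expR (n%:R * (b - x)))
      (B := expR (n%:R * b))) => //.
    - apply: measurableT_comp; first exact: measurable_expR.
      by apply: measurable_funM => //; exact: measurable_funB.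
    - move=> x hx; rewrite expR_ge0/= ler_expR ler_wpM2l// lerBlDr lerDl.
      rewrite leNgt; apply: contra_neqN hx => x0.
      by rewrite /h d0// mulr0.
    - move=> k k0.
      (* The k-th moment at frequency n is a transform at the integer frequency k n, to which [Mb]
         applies. *)
      have E (x : R) : expR (n%:R * (b - x)) ^+ k * h x =
          expR (n%:R * (b - a)) ^+ k * (expR ((k * n)%N%:R * (a - x)) * h x).
        rewrite mulrA -!expRM_natl -expRD natrM; congr (expR _ * _); ring.
      under eq_Rintegral do rewrite E.
      rewrite RintegralZl//.
        rewrite normrM ger0_norm ?exprn_ge0 ?expR_ge0// mulrC.
        by apply: ler_wpM2r; rewrite ?exprn_ge0 ?expR_ge0// Mb// muln_gt0 k0.
  have c3 : `|\int[mu]_x (\1_(`]b, +oo[) x * h x) - \int[mu]_x h x| <= 0.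
    have cn : `|\int[mu]_x (expR (- expR (n%:R * (b - x))) * h x) - \int[mu]_x h x|
       @[n --> \oo] --> `|\int[mu]_x (\1_(`]b, +oo[) x * h x) - \int[mu]_x h x|.
      by apply: cvg_norm; apply: cvgB => //; exact: cvg_cst.
    apply: (ler_cvg_to cn c2); near=> n; apply: key; near: n; exact: nbhs_infty_gt.
  have i1h : mu.-integrable setT (EFin \o (fun x => \1_(`]b, +oo[) x * h x)).
    move: ih => /integrable_abse; apply: le_integrable_real => //.
      exact: measurable_funM.
    move=> x _ /=; rewrite normrM ler_piMl//.
    by rewrite indicE; case: (x \in _); rewrite ?normr1 ?normr0.
  move: c3; rewrite distrC normr_le0 -RintegralB// => /eqP <-.
  rewrite [LHS]Rintegral_mkcond; apply: eq_Rintegral => x _.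
  rewrite patchE indicE !mem_setE !in_itv/= andbT.
  by case: (leP x b) => xb; rewrite ?(mul0r, mul1r, subr0, subrr).
have := integral_primitive_ae0 ih hI; apply: ae_imply => x + xa.
by move=> /(_ xa); rewrite /h i1 xa mul1r.
Unshelve. all: by end_near.
Qed.
End LaplaceVanish.

(** * Pairing a Bochner integral with a bounded kernel *)

Section BochnerPairing.
Context {R : realType}.
Local Notation mu := (@lebesgue_measure R).
Local Notation Rm := (measurableTypeR R).
Implicit Types (D : set R) (f g h : R -> R).

Lemma Rintegral_sum D (k : nat) (f : nat -> R -> R) : measurable D ->
  (forall i, (i < k)%N -> mu.-integrable D (EFin \o f i)) ->
  mu.-integrable D (EFin \o (fun x => \sum_(i < k) f i x)) /\
  \int[mu]_(x in D) (\sum_(i < k) f i x) = \sum_(i < k) \int[mu]_(x in D) f i x.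
Proof.
move=> mD; elim: k => [|k IH] fi.
  have i0 : mu.-integrable D (EFin \o (fun=> 0 : R)) by exact: integrable0.
  split; first by move: i0; apply: eq_integrable_real => // x _; rewrite big_ord0.
  rewrite big_ord0; under eq_Rintegral do rewrite big_ord0.
  by rewrite Rintegral_cst// mul0r.
have [|IH1 IH2] := IH; first by move=> i ik; apply: fi; rewrite ltnS ltnW.
have fk : mu.-integrable D (EFin \o f k) by exact: fi.
split.
  have := integrableD_real mD IH1 fk.
  by apply: eq_integrable_real => // x _; rewrite big_ord_recr.
rewrite big_ord_recr/= -IH2 -RintegralD//.
by apply: eq_Rintegral => x _; rewrite big_ord_recr.
Qed.

(* The distance integrated in [is_Bochner_integral] is not known to be a
   measurable function of time; for such an integrand [\int] is a lower
   integral, which is still monotone. *)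
Lemma le_lower_integral D (f g : R -> \bar R) :
  (forall x, D x -> (0 <= f x)%E) -> (forall x, D x -> (f x <= g x)%E) ->
  (\int[mu]_(x in D) f x <= \int[mu]_(x in D) g x)%E.
Proof.
move=> f0 fg; have g0 x : D x -> (0 <= g x)%E by move=> Dx; exact: le_trans (f0 x Dx) (fg x Dx).
rewrite ge0_integralE// [leRHS]ge0_integralE//.
apply: le_ereal_sup => _ [h hf <-]; exists h => //= x.
apply: le_trans (hf x) _; rewrite !patchE; case: ifPn => // /set_mem; exact: fg.
Qed.

Lemma cvge0_near_lt (u : nat -> \bar R) (e : R) : u n @[n --> \oo] --> 0%E -> 0 < e ->
  \forall n \near \oo, (u n < e%:E)%E.
Proof.
move=> u0 e0; apply: (u0 [set y | (y < e%:E)%E]).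
by apply: open_nbhs_nbhs; split; [exact: open_ereal_lt_ereal|rewrite /= lte_fin].
Qed.

Lemma integrable_kernel_mul (k f : R -> R) : measurable_fun setT k ->
  (forall x, `|k x| <= 1) -> L1 f -> mu.-integrable setT (EFin \o (fun x => k x * f x)).
Proof.
move=> mk k1 if_; have mf : measurable_fun setT f by case/integrableP : if_ => /measurable_EFinP.
move: if_ => /integrable_abse; apply: le_integrable_real => //.
  exact: measurable_funM.
by move=> x _; rewrite normrM ler_piMl.
Qed.

Lemma L1distE f g : L1dist f g = (\int[mu]_x `|(f x - g x)%:E|)%E.
Proof. by rewrite /L1dist Lnorm1. Qed.

Lemma kernel_mul_dist (k f g : R -> R) : measurable_fun setT k ->
  (forall x, `|k x| <= 1) -> L1 f -> L1 g ->
  (`|\int[mu]_x (k x * f x) - \int[mu]_x (k x * g x)|%:E <= L1dist f g)%E.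
Proof.
move=> mk k1 if_ ig.
have i1 := integrable_kernel_mul mk k1 if_; have i2 := integrable_kernel_mul mk k1 ig.
have ifg : mu.-integrable setT (EFin \o (fun x => f x - g x)).
  have := integrableD_real measurableT if_ (integrableZl_real (-1) measurableT ig).
  by apply: eq_integrable_real => // x _; rewrite mulN1r.
rewrite -RintegralB//.
have i3 : mu.-integrable setT (EFin \o (fun x => k x * f x - k x * g x)).
  have := integrable_kernel_mul mk k1 ifg.
  by apply: eq_integrable_real => // x _; rewrite mulrBr.
rewrite EFin_normr_Rintegral//.
apply: le_trans (le_abse_integral _ _ _) _ => //; first by case/integrableP : i3.
rewrite L1distE; apply: le_lower_integral => // x _.
by rewrite /= lee_fin -mulrBr normrM ler_piMl.
Qed.

(** Pairing with [k] is linear and 1-Lipschitz for [L1dist], so it commutes with the integral of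
    simple curves and passes to the limit. A separate integrand [I] is produced because the pairing
    with [F s] is known to be a limit of measurable functions only for almost every [s]. *)
Lemma Bochner_pairing D (F : R -> R -> R) (J k : R -> R) :
  measurable D -> is_Bochner_integral D F J ->
  measurable_fun setT k -> (forall x, `|k x| <= 1) ->
  exists I : R -> R, [/\ mu.-integrable D (EFin \o I),
    {ae mu, forall s, D s -> I s = \int[mu]_y (k y * F s y)} &
    \int[mu]_y (k y * J y) = \int[mu]_(s in D) I s].
Proof.
move=> mD [FL1 JL1 [K [A [g [simp aeF intF intJ]]]]] mk k1.
pose kk f := \int[mu]_y (k y * f y).
pose In n s := \sum_(i < K n) \1_(A n i) s * kk (g n i).
have scL1 n s : L1 (simple_curve (K n) (A n) (g n) s) /\
    kk (simple_curve (K n) (A n) (g n) s) = In n s.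
  have ig i : (i < K n)%N -> L1 (g n i) by move=> /simp[].
  have [h1 _] := Rintegral_sum (f := fun i y => \1_(A n i) s * g n i y) measurableT
    (fun i iK => integrableZl_real _ measurableT (ig i iK)).
  split; first exact: h1.
  have h2 i : (i < K n)%N ->
      mu.-integrable setT (EFin \o (fun y => \1_(A n i) s * (k y * g n i y))).
    by move=> iK; apply: integrableZl_real => //; apply: integrable_kernel_mul => //; exact: ig.
  have [_ E] := Rintegral_sum measurableT h2.
  rewrite /kk /simple_curve /In.
  under eq_Rintegral => y _.
    rewrite mulr_sumr; under eq_bigr do rewrite mulrCA; over.
  rewrite E; apply: eq_bigr => i _; rewrite RintegralZl//.
  by apply: integrable_kernel_mul => //; exact: ig.
have sciE n : L1 (simple_curve_integral (K n) (A n) (g n)) /\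
    kk (simple_curve_integral (K n) (A n) (g n)) = \sum_(i < K n) fine (mu (A n i)) * kk (g n i).
  have ig i : (i < K n)%N -> L1 (g n i) by move=> /simp[].
  have [h1 _] := Rintegral_sum (f := fun i y => fine (mu (A n i)) * g n i y) measurableT
    (fun i iK => integrableZl_real _ measurableT (ig i iK)).
  split; first exact: h1.
  have h2 i : (i < K n)%N ->
      mu.-integrable setT (EFin \o (fun y => fine (mu (A n i)) * (k y * g n i y))).
    by move=> iK; apply: integrableZl_real => //; apply: integrable_kernel_mul => //; exact: ig.
  have [_ E] := Rintegral_sum measurableT h2.
  rewrite /kk /simple_curve_integral.
  under eq_Rintegral => y _.
    rewrite mulr_sumr; under eq_bigr do rewrite mulrCA; over.
  rewrite E; apply: eq_bigr => i _; rewrite RintegralZl//.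
  by apply: integrable_kernel_mul => //; exact: ig.
have InP n : mu.-integrable D (EFin \o In n) /\
    \int[mu]_(s in D) In n s = \sum_(i < K n) fine (mu (A n i)) * kk (g n i).
  have i1 i : (i < K n)%N -> mu.-integrable D (EFin \o (fun s => \1_(A n i) s)).
    move=> /simp[mA AD Afin _].
    apply/integrableP; split.
      by apply/measurable_EFinP; apply: measurable_funTS; exact: measurable_indic.
    under eq_integral => s _ do rewrite /= ger0_norm//.
    by rewrite integral_indic// setIidl.
  have i2 i : (i < K n)%N -> mu.-integrable D (EFin \o (fun s => kk (g n i) * \1_(A n i) s)).
    by move=> iK; apply: integrableZl_real => //; exact: i1.
  have [h1 h2] := Rintegral_sum mD i2.
  split.
    move: h1; apply: eq_integrable_real => // s _.
    by apply: eq_bigr => i _; rewrite mulrC.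
  under eq_Rintegral => s _.
    rewrite /In; under eq_bigr do rewrite mulrC; over.
  rewrite h2; apply: eq_bigr => i _.
  have [mA AD Afin _] := simp n i (ltn_ord i).
  rewrite RintegralZl//; last exact: i1.
  by rewrite mulrC /Rintegral integral_indic// setIidl.
have mIn n : measurable_fun D (In n) by case: (InP n) => /integrableP[/measurable_EFinP].
have Ib n s : D s -> (`|In n s - kk (F s)|%:E <= L1dist (simple_curve (K n) (A n) (g n) s) (F s))%E.
  move=> Ds; rewrite -(scL1 n s).2.
  by apply: kernel_mul_dist => //; [exact: (scL1 n s).1|exact: FL1].
have [N0 [mN0 N00 subN0]] := aeF.
(* Setting [I] to 0 on the exceptional set makes it a limit everywhere on [D], hence measurable. *)
pose I s := \1_(~` N0) s * kk (F s).
have cI s : D s -> (\1_(~` N0) s * In n s) @[n --> \oo] --> I s.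
  move=> Ds; rewrite /I indicE; case: (boolP (s \in ~` N0)) => sN; last first.
    by rewrite mul0r; under eq_cvg do rewrite mul0r; exact: cvg_cst.
  rewrite mul1r; under eq_cvg do rewrite mul1r.
  have : L1dist (simple_curve (K n) (A n) (g n) s) (F s) @[n --> \oo] --> 0%E.
    apply: contrapT => h; move: sN; rewrite inE /setC/=; apply; apply: subN0 => /= h2.
    by apply: h; exact: h2.
  move=> cL; apply/cvgrPdist_lt => e e0.
  near=> n; rewrite distrC -lte_fin (le_lt_trans (Ib n s Ds))//; near: n.
  exact: cvge0_near_lt.
have mN0c : measurable (~` N0) by exact: measurableC.
have mI : measurable_fun D I.
  apply: (measurable_fun_cvg (h := fun n s => \1_(~` N0) s * In n s)) => [n|s Ds].
    apply: measurable_funM; last exact: mIn.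
    by apply: measurable_funTS; exact: measurable_indic.
  exact: cI.
have IE : {ae mu, forall s, D s -> I s = kk (F s)}.
  exists N0; split => // s /= /not_implyP[Ds]; rewrite /I indicE.
  by case: (boolP (s \in ~` N0)) => [|/negP]; rewrite ?mul1r// inE/= => /contrapT.
have mB n : measurable_fun D (fun s => In n s - I s).
  by apply: measurable_funB; [exact: mIn|exact: mI].
have mBn n : measurable_fun D (fun s => `|In n s - I s|).
  by apply: measurableT_comp (mB n).
have dI n : (\int[mu]_(s in D) `|(In n s - I s)%:E| <=
    \int[mu]_(s in D) L1dist (simple_curve (K n) (A n) (g n) s) (F s))%E.
  (* [le_lower_integral] needs a bound at every point. The indicator provides it, and inserting it
     is harmless on the left, where the integrand is measurable. *)
  apply: (@le_trans _ _ (\int[mu]_(s in D) (\1_(~` N0) s * `|In n s - I s|)%:E)%E).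
    rewrite le_eqVlt; apply/orP; left; apply/eqP; apply: ae_eq_integral => //.
    - by apply/measurable_EFinP; exact: mBn.
    - apply/measurable_EFinP; apply: measurable_funM.
        by apply: measurable_funTS; exact: measurable_indic.
      exact: mBn.
    - exists N0; split => // s /= /not_implyP[Ds]; rewrite indicE.
      by case: (boolP (s \in ~` N0)) => [|/negP]; rewrite ?mul1r// inE/= => /contrapT.
  apply: le_lower_integral => s Ds; first by rewrite lee_fin mulr_ge0.
  apply: le_trans (Ib n s Ds); rewrite lee_fin /I indicE.
  by case: (s \in ~` N0); rewrite ?mul0r// !mul1r.
have iI : mu.-integrable D (EFin \o I).
  (* A single approximation at finite distance suffices: [I] is then an integrable simple function
     minus an integrable difference. *)
  have [n /= hn] : exists n,
      (\int[mu]_(s in D) L1dist (simple_curve (K n) (A n) (g n) s) (F s) < 1%:E)%E.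
    have [n _ /(_ n (leqnn n)) hn] := cvge0_near_lt intF ltr01.
    by exists n.
  have [iIn _] := InP n.
  have iB : mu.-integrable D (EFin \o (fun s => In n s - I s)).
    apply/integrableP; split; first by apply/measurable_EFinP; exact: mB.
    by apply: le_lt_trans (dI n) _; apply: lt_trans hn _; rewrite ltry.
  have := integrableD_real mD iIn (integrableZl_real (-1) mD iB).
  by apply: eq_integrable_real => // s _ ; rewrite mulN1r; ring.
exists I; split => //.
apply/eqP; rewrite -subr_eq0 -normr_le0; apply/ler_addgt0Pr => e e0; rewrite add0r.
have e2 : 0 < e / 2 by rewrite divr_gt0.
have [n _ /(_ n (leqnn n))[h1 h2]] : \forall n \near \oo,
    (\int[mu]_(s in D) L1dist (simple_curve (K n) (A n) (g n) s) (F s) < (e / 2)%:E)%E /\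
    (L1dist (simple_curve_integral (K n) (A n) (g n)) J < (e / 2)%:E)%E.
  near=> n; split; near: n; exact: cvge0_near_lt.
have [[iIn InE] [s1 s2]] := (InP n, sciE n).
have d1 : `|kk (simple_curve_integral (K n) (A n) (g n)) - kk J| <= e / 2.
  rewrite -lee_fin; apply: le_trans (ltW h2); exact: kernel_mul_dist.
have d2 : `|\int[mu]_(s in D) In n s - \int[mu]_(s in D) I s| <= e / 2.
  have iB : mu.-integrable D (EFin \o (fun s => In n s - I s)).
    have := integrableD_real mD iIn (integrableZl_real (-1) mD iI).
    by apply: eq_integrable_real => // s _; rewrite mulN1r.
  rewrite -RintegralB// -lee_fin EFin_normr_Rintegral//.
  apply: le_trans (le_abse_integral _ _ _) _ => //; first by case/integrableP : iB.
  by apply: le_trans (dI n) _; exact: ltW.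
rewrite InE -s2 in d2.
rewrite (_ : _ - _ = - (kk (simple_curve_integral (K n) (A n) (g n)) - kk J) +
  (kk (simple_curve_integral (K n) (A n) (g n)) - \int[mu]_(s in D) I s)); last by rewrite /kk; ring.
by rewrite (le_trans (ler_normD _ _))// normrN (splitr e) lerD.
Unshelve. all: by end_near.
Qed.
End BochnerPairing.

(** * Composing phi with an absolutely continuous curve *)

Section Primitive.
Context {R : realType}.
Local Notation mu := (@lebesgue_measure R).
Local Notation Rm := (measurableTypeR R).
Local Notation normc := (@Normc.normc R).
Local Notation Re := (@complex.Re R).
Local Notation Im := (@complex.Im R).

Section Polynomial.
Variables (N : nat) (p : nat -> R).
Hypotheses (hp0 : forall j, (1 <= j <= N)%N -> 0 <= p j)
  (hp1 : \sum_(1 <= j < N.+1) p j = 1).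
Implicit Types z w : R[i].

Lemma normcX z n : normc (z ^+ n) = normc z ^+ n.
Proof.
elim: n => [|n IH]; first by rewrite !expr0 Normc.normc1.
by rewrite !exprS Normc.normcM IH.
Qed.

Lemma ler_normc_sum (s : seq nat) (F : nat -> R[i]) :
  normc (\sum_(j <- s) F j) <= \sum_(j <- s) normc (F j).
Proof.
elim: s => [|j s IH]; first by rewrite !big_nil Normc.normc0.
by rewrite !big_cons (le_trans (ler_normcD _ _))// lerD2l.
Qed.

(** [Qpoly] has no constant term, so it is a convex combination of powers each bounded by |z|. *)
Lemma normc_Qpoly_le z : normc z <= 1 -> normc (Qpoly p N z) <= normc z.
Proof.
move=> z1; rewrite (le_trans (ler_normc_sum _ _))//.
rewrite -[leRHS]mul1r -hp1 mulr_suml big_nat [leRHS]big_nat.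
apply: ler_sum => j /andP[j1 jN]; rewrite Normc.normcM normcX normc_real.
have pj : 0 <= p j by apply: hp0; rewrite j1.
rewrite ger0_norm// ler_wpM2l//; case: j j1 {jN pj} => // j _.
by rewrite exprS ler_piMr ?normc_ge0// exprn_ile1 ?normc_ge0.
Qed.

Lemma one_sub_Qpoly_neq0 z : normc z < 1 -> 1 - Qpoly p N z != 0.
Proof.
move=> z1; apply/eqP => /eqP; rewrite subr_eq0 => /eqP E.
have := normc_Qpoly_le (ltW z1).
by rewrite -E Normc.normc1 leNgt z1.
Qed.

Lemma normc_subX z w n : normc z <= 1 -> normc w <= 1 ->
  normc (z ^+ n - w ^+ n) <= n%:R * normc (z - w).
Proof.
move=> z1 w1; elim: n => [|n IH]; first by rewrite !expr0 subrr Normc.normc0 mul0r.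
rewrite (_ : _ - _ = z * (z ^+ n - w ^+ n) + w ^+ n * (z - w)); last first.
  by rewrite !exprS; ring.
rewrite (le_trans (ler_normcD _ _))// !Normc.normcM -natr1 mulrDl mul1r lerD//.
  by rewrite (le_trans _ IH)// ler_piMl ?normc_ge0.
by rewrite ler_piMl ?normc_ge0// normcX exprn_ile1 ?normc_ge0.
Qed.

Lemma Qpoly_lipschitz z w : normc z <= 1 -> normc w <= 1 ->
  normc (Qpoly p N z - Qpoly p N w) <= N%:R * normc (z - w).
Proof.
move=> z1 w1; rewrite /Qpoly -sumrB (le_trans (ler_normc_sum _ _))//.
rewrite -[leRHS]mul1r -[X in X * _]hp1 mulr_suml big_nat [leRHS]big_nat.
apply: ler_sum => j /andP[j1 jN].
have pj : 0 <= p j by apply: hp0; rewrite j1.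
rewrite -mulrBr Normc.normcM normc_real ger0_norm// ler_wpM2l//.
rewrite (le_trans (normc_subX _ _ _))// ler_wpM2r ?normc_ge0//.
by rewrite ler_nat.
Qed.

End Polynomial.

(** Translates the derivative over the field [R[i]], whose norm takes values in [R[i]], into an
    estimate with real moduli and a real radius. *)
Lemma is_derive_normc (phi : R[i]^o -> R[i]^o) (z : R[i]^o) (d : R[i]) :
  is_derive z 1 phi d -> forall e : R, 0 < e -> exists2 r : R, 0 < r &
  forall h : R[i], normc h < r ->
    normc (phi (z + h) - phi z - d * h) <= e * normc h.
Proof.
move=> [dphi dE] e e0.
have eC : 0 < e%:C by rewrite ltcR.
have := dphi; rewrite /derivable => /cvg_ex[/= l cl].
have ld : l = d by rewrite -dE /derive; apply/esym/cvg_lim.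
rewrite {}ld in cl.
move: cl => /cvgrPdist_lt /(_ e%:C eC).
move=> [/= r r0 hr].
(* A positive element of [R[i]] has zero imaginary part. *)
have [rr rR] : exists2 rr : R, 0 < rr & r = rr%:C.
  move: r0; rewrite ltcE/= => /andP[/eqP ri rr0].
  by exists (Re r) => //; apply: complex_eq.
move=> rE; exists rr => // h hrr.
have [->|h0] := eqVneq h 0.
  by rewrite addr0 subrr mulr0 subr0 Normc.normc0 mulr0.
have := hr h; rewrite /ball_/= sub0r normrN rE.
have nh : `|h| < rr%:C by rewrite normrC_normc ltcR.
move=> /(_ nh h0); rewrite normrC_normc ltcR => /ltW.
rewrite [h *: 1]mulr1 (addrC h) => hb.
have -> : phi (z + h) - phi z - d * h = - h * (d - h^-1 *: (phi (z + h) - phi z)).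
  rewrite -[h^-1 *: _]/(h^-1 * (phi (z + h) - phi z)) mulrBr !mulNr mulrA mulfV//.
  by rewrite mul1r opprK addrC mulrC.
by rewrite Normc.normcM normcN1 mulrC ler_wpM2r ?normc_ge0.
Qed.

(** A mean value inequality by continuous induction: the supremum of the good times is itself good,
    and if it were below [b] the local bound there would extend past it. Monotonicity of [V] lets
    the bounds add up; neither function is assumed continuous. *)
Lemma locally_dominated_le (Phi V : R -> R) (a b : R) : a <= b ->
  (forall s t, a <= s -> s <= t -> t <= b -> V s <= V t) ->
  (forall t, a <= t <= b -> exists2 r : R, 0 < r &
    forall s, a <= s <= b -> `|s - t| < r -> `|Phi s - Phi t| <= `|V s - V t|) ->
  `|Phi b - Phi a| <= V b - V a.
Proof.
move=> ab Vnd loc.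
pose S := [set t : R | a <= t <= b /\ `|Phi t - Phi a| <= V t - V a].
have Sa : S a by split; rewrite ?lexx ?ab// !subrr normr0.
have Sub : has_sup S.
  by split; [exists a | exists b => t [/andP[]]].
pose c := sup S.
have ac : a <= c by apply: ub_le_sup => //; exact: Sub.2.
have cb : c <= b by apply: ge_sup; [exists a|move=> t [/andP[]]].
have [r r0 hr] := loc c (introT andP (conj ac cb)).
have Sc : S c.
  have [s Ss cs] := sup_adherent r0 Sub.
  have sc : s <= c by apply: ub_le_sup => //; exact: Sub.2.
  have [/andP[as_ sb] hs] := Ss.
  split; first by rewrite ac.
  have := hr s; rewrite as_ sb => /(_ isT).
  rewrite distrC ger0_norm ?subr_ge0// ltrBlDr -ltrBlDl => /(_ _) hsc.
  have {}hsc : `|Phi s - Phi c| <= `|V s - V c| by apply: hsc; rewrite -/c in cs; lra.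
  rewrite distrC (distrC (V s)) (ger0_norm (_ : 0 <= V c - V s)) ?subr_ge0 ?Vnd// in hsc.
  rewrite (_ : Phi c - Phi a = (Phi c - Phi s) + (Phi s - Phi a)); last by ring.
  rewrite (_ : V c - V a = (V c - V s) + (V s - V a)); last by ring.
  by rewrite (le_trans (ler_normD _ _))// lerD.
have cE : c = b.
  apply/eqP; rewrite eq_le cb leNgt; apply/negP => cb'.
  pose s := Num.min b (c + r / 2).
  have cs : c < s by rewrite lt_min cb' ltrDl divr_gt0.
  have sb : s <= b by rewrite ge_min lexx.
  have as_ : a <= s by rewrite (le_trans ac)// ltW.
  have scr : `|s - c| < r.
    rewrite ger0_norm ?subr_ge0 ?(ltW cs)// ltrBlDl gt_min ltrD2l; apply/orP; right.
    by rewrite ltr_pdivrMr// ltr_pMr// ltr1n.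
  have := hr s; rewrite as_ sb => /(_ isT scr).
  rewrite (ger0_norm (_ : 0 <= V s - V c)) ?subr_ge0 ?Vnd ?(ltW cs)// => hs.
  have : S s.
    split; first by rewrite as_.
    rewrite (_ : Phi s - Phi a = (Phi s - Phi c) + (Phi c - Phi a)); last by ring.
    rewrite (_ : V s - V a = (V s - V c) + (V c - V a)); last by ring.
    by rewrite (le_trans (ler_normD _ _))// lerD// Sc.2.
  by move=> Ss; have := ub_le_sup Sub.2 Ss; rewrite leNgt cs.
by rewrite -cE; exact: Sc.2.
Qed.

Lemma locally_dominated_const (Phi V : R -> R) (a b : R) : a <= b ->
  (forall s t, a <= s -> s <= t -> t <= b -> V s <= V t) ->
  (forall e t, 0 < e -> a <= t <= b -> exists2 r : R, 0 < r &
    forall s, a <= s <= b -> `|s - t| < r -> `|Phi s - Phi t| <= e * `|V s - V t|) ->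
  Phi b = Phi a.
Proof.
move=> ab Vnd loc.
have H e : 0 < e -> `|Phi b - Phi a| <= e * (V b - V a).
  move=> e0; rewrite mulrBr.
  apply: (@locally_dominated_le Phi (fun t => e * V t)) => // [s t as_ st tb|t tab].
    by rewrite ler_wpM2l ?(ltW e0)// Vnd.
  have [r r0 hr] := loc e t e0 tab; exists r => // s sab st.
  by rewrite -mulrBr normrM (gtr0_norm e0) hr.
apply/eqP; rewrite -subr_eq0 -normr_le0; apply/ler_addgt0Pr => e e0; rewrite add0r.
have V0 : 0 <= V b - V a by rewrite subr_ge0 Vnd.
(* The summand 1 covers the case [V a = V b]. *)
have e1 : 0 < e / (V b - V a + 1) by rewrite divr_gt0// ltr_wpDl.
rewrite (le_trans (H _ e1))// mulrAC ler_pdivrMr ?ltr_wpDl//.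
by rewrite ler_wpM2l ?(ltW e0)// lerDl.
Qed.

End Primitive.

Section PrimitiveAlongCurve.
Context {R : realType}.
Local Notation mu := (@lebesgue_measure R).
Local Notation Rm := (measurableTypeR R).
Local Notation normc := (@Normc.normc R).
Local Notation Re := (@complex.Re R).
Local Notation Im := (@complex.Im R).

Lemma Rintegral_itv_cat (f : R -> R) (a s b : R) : a <= s -> s <= b ->
  mu.-integrable `[a, b] (EFin \o f) ->
  \int[mu]_(x in `[a, b]) f x = \int[mu]_(x in `[a, s]) f x + \int[mu]_(x in `[s, b]) f x.
Proof.
move=> as_ sb fi; rewrite -[X in _ = _ + X]Rintegral_itv_obnd_cbnd; last first.
  by apply: integrableS fi => //; apply: subset_itvr; rewrite bnd_simp.
by rewrite -(Rintegral_itvB fi) ?bnd_simp// addrC subrK.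
Qed.

Lemma Cint_itv_cat (f : R -> R[i]) (a s b : R) : a <= s -> s <= b ->
  Cintegrable `[a, b] f -> Cint `[a, b] f = Cint `[a, s] f + Cint `[s, b] f.
Proof.
by move=> as_ sb [f1 f2]; apply: complex_eq; exact: Rintegral_itv_cat.
Qed.

Lemma normc_Cint_le_ae (D : set R) (f : R -> R[i]) (g : R -> R) : measurable D ->
  Cintegrable D f -> (forall x, 0 <= g x) ->
  {ae mu, forall x, D x -> normc (f x) <= g x} -> mu.-integrable D (EFin \o g) ->
  normc (Cint D f) <= \int[mu]_(x in D) g x.
Proof.
move=> mD fi g0 [N [mN N0 subN]] gi.
pose f' x := (\1_(~` N) x)%:C * f x.
have mNc : measurable (~` N) by exact: measurableC.
have mf' : Cmeasurable D f'.
  apply: CmeasurableM; last exact: Cintegrable_measurable.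
  by apply: Cmeasurable_real; apply: measurable_funTS; exact: measurable_indic.
have f'E x : f' x = if x \in ~` N then f x else 0.
  by rewrite /f' indicE; case: ifP => _; rewrite ?mul1r// mul0r.
have f'g x : D x -> normc (f' x) <= g x.
  move=> Dx; rewrite f'E; case: ifPn => [|_]; last by rewrite Normc.normc0.
  rewrite inE => xN; apply: contrapT => h; apply: xN; apply: subN => /= h2.
  by apply: h; exact: h2.
have if' : Cintegrable D f' by exact: le_Cintegrable f'g gi.
rewrite (_ : Cint D f = Cint D f'); first exact: normc_Cint_le f'g gi.
apply: ae_eq_Cint => //; first exact: Cintegrable_measurable.
exists N; split => // x /= /not_implyP[Dx]; rewrite f'E.
by case: ifPn => // /negP; rewrite inE => /contrapT.
Qed.

(** Formally d(phi(g)) = phi'(g) dg = -K dt. Since [K] is only integrable, this is proved through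
    increments: those of phi(g) plus the primitive of [K] are o(|V s - V t|) at every t, where [V]
    is the primitive of a majorant of |K|, so [locally_dominated_const] applies. The integrand [I]
    may depend on s and t and is fixed only up to null sets, which is all that the paired equation
    supplies. *)
Lemma primitive_along_curve (N : nat) (p : nat -> R)
  (hp0 : forall j, (1 <= j <= N)%N -> 0 <= p j)
  (hp1 : \sum_(1 <= j < N.+1) p j = 1)
  (phi : R[i]^o -> R[i]^o) (hphi : is_phi p N phi)
  (g K : R -> R[i]) (a b : R) : a <= b ->
  (forall t, a <= t <= b -> normc (g t) < 1) ->
  Cintegrable `[a, b] K ->
  (forall s t, a <= s -> s <= t -> t <= b -> exists I : R -> R[i],
    [/\ Cintegrable `[s, t] I,
        {ae mu, forall u, `[s, t]%classic u -> I u = K u * (1 - Qpoly p N (g u))} &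
        g t - g s = - Cint `[s, t] I]) ->
  phi (g b) = phi (g a) - Cint `[a, b] K.
Proof.
move=> ab g1 iK hI.
pose k u := `|Re (K u)| + `|Im (K u)|.
have k0 u : 0 <= k u by rewrite addr_ge0.
have Kk u : normc (K u) <= k u by exact: normc_le_ReIm.
have ik : mu.-integrable `[a, b] (EFin \o k).
  by apply: integrableD_real => //;
    [move: iK => [+ _]|move: iK => [_ +]] => /integrable_abse; apply: eq_integrable_real.
have subi s t : a <= s -> t <= b -> [set` `[s, t]] `<=` [set` `[a, b]].
  by move=> as_ tb; apply: subset_itv; rewrite bnd_simp.
pose V t := \int[mu]_(u in `[a, t]) k u.
have VB s t : a <= s -> s <= t -> t <= b -> V t - V s = \int[mu]_(u in `[s, t]) k u.
  move=> as_ st tb; apply/eqP; rewrite subr_eq addrC.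
  apply/eqP/Rintegral_itv_cat => //.
  by apply: integrableS ik => //; exact: subi.
pose B t := Cint `[a, t] K.
have BB s t : a <= s -> s <= t -> t <= b -> B t - B s = Cint `[s, t] K.
  move=> as_ st tb; apply/eqP; rewrite subr_eq addrC.
  apply/eqP/Cint_itv_cat => //.
  by apply: CintegrableS iK => //; exact: subi.
have Vnd s t : a <= s -> s <= t -> t <= b -> V s <= V t.
  by move=> as_ st tb; rewrite -subr_ge0 VB// Rintegral_ge0.
have Vc t (e : R) : a <= t <= b -> 0 < e -> exists2 r : R, 0 < r &
    forall s, a <= s <= b -> `|s - t| < r -> `|V s - V t| < e.
  move=> tab e0.
  have := parameterized_integral_continuous ab ik.
  move=> /subspace_continuousP /(_ t); rewrite /= in_itv/= => /(_ tab).
  move=> /cvgrPdist_lt /(_ e e0); rewrite /within/= => -[r /= r0 hr].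
  exists r => // s sab st; rewrite distrC; apply: hr => /=; first by rewrite distrC.
  by rewrite in_itv.
have iS s t (f : R -> R) : a <= s -> t <= b -> mu.-integrable `[a, b] (EFin \o f) ->
    mu.-integrable `[s, t] (EFin \o f).
  by move=> as_ tb fi; apply: integrableS fi => //; exact: subi.
(* The factor 2 bounds |1 - Q(g)|, as |Q(g)| <= |g| < 1. *)
have gb s t : a <= s -> s <= t -> t <= b -> normc (g t - g s) <= 2 * (V t - V s).
  move=> as_ st tb; have [I [iI IE ->]] := hI s t as_ st tb.
  have ik2 : mu.-integrable `[s, t] (EFin \o (fun u => 2 * k u)).
    by apply: integrableZl_real => //; exact: iS ik.
  rewrite normcN1 VB// -RintegralZl//; last exact: iS ik.
  apply: normc_Cint_le_ae => //; first by move=> u; rewrite mulr_ge0.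
  apply: ae_imply IE => u Iu stu; rewrite Iu// Normc.normcM mulrC.
  have uab : a <= u <= b.
    by move: stu; rewrite /= in_itv/= => /andP[su ut]; rewrite (le_trans as_ su) (le_trans ut tb).
  apply: ler_pM; rewrite ?normc_ge0//.
  rewrite (le_trans (ler_normcB _ _))// Normc.normc1 -[2]/(1 + 1) lerD2l.
  by rewrite (le_trans (normc_Qpoly_le hp0 hp1 (ltW (g1 u uab))))// ltW// g1.
(* Freezing Q(g) at t0 costs an error quadratic in V, because g varies at most
   like 2 V. *)
have key t0 s t : a <= s -> s <= t -> t <= b -> s <= t0 <= t ->
    normc ((g t - g s) + (1 - Qpoly p N (g t0)) * (B t - B s)) <=
    2 * N%:R * (V t - V s) ^+ 2.
  move=> as_ st tb /andP[st0 t0t]; have [I [iI IE ->]] := hI s t as_ st tb.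
  rewrite BB//; have iKst : Cintegrable `[s, t] K by apply: CintegrableS iK => //; exact: subi.
  rewrite -CintZ// addrC -CintB//; last exact: CintegrableZ.
  set W := V t - V s.
  have W0 : 0 <= W by rewrite subr_ge0 Vnd.
  rewrite (_ : _ * W ^+ 2 = (2 * N%:R * W) * W); last by ring.
  rewrite {2}/W VB// -RintegralZl//; last exact: iS ik.
  apply: normc_Cint_le_ae => //.
  - by apply: CintegrableB => //; exact: CintegrableZ.
  - by move=> u; rewrite !mulr_ge0.
  - apply: ae_imply IE => u Iu stu; rewrite Iu//.
    move: stu; rewrite /= in_itv/= => /andP[su ut].
    have uab : a <= u <= b by rewrite (le_trans as_ su) (le_trans ut tb).
    have t0ab : a <= t0 <= b by rewrite (le_trans as_ st0) (le_trans t0t tb).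
    rewrite (_ : _ - _ = K u * (Qpoly p N (g u) - Qpoly p N (g t0))); last by ring.
    rewrite Normc.normcM mulrC ler_pM ?normc_ge0//.
    rewrite (le_trans (Qpoly_lipschitz hp0 hp1 (ltW (g1 u uab)) (ltW (g1 t0 t0ab))))//.
    rewrite -mulrA mulrCA ler_wpM2l//.
    have [/andP[au ub] /andP[at0 t0b]] := (uab, t0ab).
    have [ut0|/ltW t0u] := leP u t0.
      rewrite normcBC (le_trans (gb u t0 au ut0 t0b))//.
      by apply: ler_wpM2l => //; apply: lerB; apply: Vnd.
    rewrite (le_trans (gb t0 u at0 t0u ub))//.
    by apply: ler_wpM2l => //; apply: lerB; apply: Vnd.
  - by apply: integrableZl_real => //; exact: iS ik.
pose Phi t : R[i] := phi (g t) + B t.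
have loc (e t : R) : 0 < e -> a <= t <= b -> exists2 r : R, 0 < r &
    forall s, a <= s <= b -> `|s - t| < r -> normc (Phi s - Phi t) <= e * `|V s - V t|.
  move=> e0 tab; have g1t := g1 t tab.
  set c0 := 1 - Qpoly p N (g t).
  have c00 : c0 != 0 by exact: one_sub_Qpoly_neq0 g1t.
  have e4 : 0 < e / 4 by rewrite divr_gt0.
  have hd := hphi.2 (g t); rewrite normrC_normc ltcR in hd.
  have [d d0 hd'] := is_derive_normc (hd g1t) e4.
  set m := normc c0^-1.
  have m0 : 0 <= m by exact: normc_ge0.
  (* With |g s - g t| <= 2 W, the bound d / 2 brings the increment into the range of the derivative
     estimate. The other bound makes the quadratic error, divided by c0, at most (e / 2) W; its
     summand 1 keeps the denominator positive. *)
  pose w := Num.min (d / 2) (e / (4 * (m * N%:R + 1))).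
  have mN0 : 0 < 4 * (m * N%:R + 1) :> R by rewrite mulr_gt0// ltr_wpDl// mulr_ge0.
  have w0 : 0 < w by rewrite lt_min !divr_gt0.
  have [r r0 hr] := Vc t w tab w0.
  exists r => // s sab sr; have := hr s sab sr; set W := `|V s - V t| => Ww.
  have W0 : 0 <= W by exact: normr_ge0.
  have [gW cW] : normc (g s - g t) <= 2 * W /\
      normc ((g s - g t) + c0 * (B s - B t)) <= 2 * N%:R * W ^+ 2.
    move: sab tab => /andP[as_ sb] /andP[at_ tb].
    rewrite /W; have [st|ts] := leP s t.
      have V0 : 0 <= V t - V s by rewrite subr_ge0 Vnd.
      rewrite distrC ger0_norm//; split; first by rewrite normcBC gb.
      rewrite (_ : _ + _ = - ((g t - g s) + c0 * (B t - B s))); last by ring.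
      by rewrite normcN1 key// st lexx.
    have V0 : 0 <= V s - V t by rewrite subr_ge0 Vnd// ltW.
    rewrite ger0_norm//; split; first by rewrite gb// ltW.
    by rewrite key// ?lexx ltW.
  have hW1 : W < d / 2 by move: Ww; rewrite lt_min => /andP[].
  have hW2 : W < e / (4 * (m * N%:R + 1)) by move: Ww; rewrite lt_min => /andP[].
  have hgd : normc (g s - g t) < d by rewrite (le_lt_trans gW)//; lra.
  have := hd' _ hgd; rewrite [g t + _]addrC subrK => hphi1.
  (* Linearization error of phi plus the error of freezing Q(g) at t, multiplied by phi'(g t) = 1 /
     c0. *)
  rewrite (_ : Phi s - Phi t = (phi (g s) - phi (g t) - c0^-1 * (g s - g t)) +
     c0^-1 * ((g s - g t) + c0 * (B s - B t))); last first.
    have -> : c0^-1 * ((g s - g t) + c0 * (B s - B t)) =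
        c0^-1 * (g s - g t) + (B s - B t) by rewrite [LHS]mulrDr mulKf.
    have ringE (x y z u v : R[i]) : x + u - (y + v) = (x - y - z) + (z + (u - v)).
      by ring.
    exact: ringE.
  rewrite (le_trans (ler_normcD _ _))// Normc.normcM -/m.
  have t1 : normc (phi (g s) - phi (g t) - c0^-1 * (g s - g t)) <= e / 2 * W.
    rewrite (le_trans hphi1)// (le_trans (ler_wpM2l (ltW e4) gW))//.
    by rewrite le_eqVlt; apply/orP; left; apply/eqP; field.
  have t2 : m * normc (g s - g t + c0 * (B s - B t)) <= e / 2 * W.
    rewrite (le_trans (ler_wpM2l m0 cW))//.
    rewrite (_ : _ * (_ * W ^+ 2) = (2 * (m * N%:R * W)) * W); last by ring.
    rewrite ler_wpM2r//.
    move: hW2; rewrite ltr_pdivlMr// => hW2; nra.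
  rewrite (_ : e * W = e / 2 * W + e / 2 * W); first exact: lerD.
  by rewrite -mulrDl -splitr.
have locR : Re (Phi b) = Re (Phi a).
  apply: (@locally_dominated_const R (Re \o Phi) V a b ab Vnd) => e t e0 tab.
  have [r r0 hr] := loc e t e0 tab; exists r => // s sab st.
  by rewrite /= -Re_oppc -Re_addc (le_trans (Re_le_normc _))// hr.
have locI : Im (Phi b) = Im (Phi a).
  apply: (@locally_dominated_const R (Im \o Phi) V a b ab Vnd) => e t e0 tab.
  have [r r0 hr] := loc e t e0 tab; exists r => // s sab st.
  by rewrite /= -Im_oppc -Im_addc (le_trans (Im_le_normc _))// hr.
have := complex_eq locR locI; rewrite /Phi.
have -> : B a = 0.
  by rewrite /B set_itv1; apply: complex_eq; rewrite /= Rintegral_set1.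
by rewrite addr0 => <-; rewrite addrK.
Qed.

End PrimitiveAlongCurve.

(** * The solution along characteristics *)

Section Step.
Context {R : realType}.
Local Notation mu := (@lebesgue_measure R).
Local Notation Rm := (measurableTypeR R).
Local Notation normc := (@Normc.normc R).
Local Notation Re := (@complex.Re R).
Local Notation Im := (@complex.Im R).
Implicit Types (f : R -> R) (z xi : R[i]).

Lemma Im_scale (c : R) xi : Im (c%:C * xi) = c * Im xi.
Proof. by rewrite Im_mulc /= mul0r addr0. Qed.

Lemma Re_scale (c : R) xi : Re (c%:C * xi) = c * Re xi.
Proof. by rewrite Re_mulc /= mul0r subr0. Qed.

Lemma L1_Sop s f : L1 f -> L1 (Sop s f).
Proof.
move=> if_; have mf := L1_measurable if_.
have := integrable_affine 0 (expR_gt0 s) if_.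
move=> /integrable_abse; apply: le_integrable_real => //; first exact: measurable_Sop.
move=> x _ /=; rewrite addr0 /Sop; case: ifP => // _.
by rewrite normr0.
Qed.

Lemma L1_T1op f : L1 f -> L1 (T1op f).
Proof.
move=> if_; have mf := L1_measurable if_.
have := integrable_affine (-1) ltr01 if_.
move=> /integrable_abse; apply: le_integrable_real => //; first exact: measurable_T1op.
move=> x _ /=; rewrite !mul1r /T1op; case: ifP => // _.
by rewrite normr0.
Qed.

Lemma Lcut_integrable r z f : 0 <= r -> Im z <= 0 -> L1 f ->
  Cintegrable `[r, +oo[ (kmul z f).
Proof.
move=> r0 z0 if_; apply: integrable_kmul_L1 => // x /=.
by rewrite in_itv/= andbT; exact: le_trans.
Qed.

Lemma LcutD r z f g : 0 <= r -> Im z <= 0 -> L1 f -> L1 g ->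
  Lcut r z (f \+ g) = Lcut r z f + Lcut r z g.
Proof.
move=> r0 z0 if_ ig; rewrite /Lcut -CintD//; try exact: Lcut_integrable.
by apply: eq_Cint => x _; rewrite /kmul rmorphD mulrDr.
Qed.

Lemma LcutZ r z f (c : R) : 0 <= r -> Im z <= 0 -> L1 f ->
  Lcut r z (fun x => c * f x) = c%:C * Lcut r z f.
Proof.
move=> r0 z0 if_; rewrite /Lcut -CintZ//; last exact: Lcut_integrable.
by apply: eq_Cint => x _; rewrite /kmul rmorphM/= mulrCA.
Qed.

Lemma ae_eq_Lcut r z f g : measurable_fun setT f -> measurable_fun setT g ->
  ae_eq mu setT f g -> Lcut r z f = Lcut r z g.
Proof.
move=> mf mg fg; apply: ae_eq_Cint => //.
- by apply: measurable_kmul; exact: measurable_funTS.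
- by apply: measurable_kmul; exact: measurable_funTS.
- by apply: ae_imply fg => x fgx _; rewrite /kmul fgx.
Qed.

Lemma Lcut_Bochner_pairing D F J r z : measurable D -> is_Bochner_integral D F J ->
  0 <= r -> Im z <= 0 ->
  exists I : R -> R[i], [/\ Cintegrable D I,
    {ae mu, forall s, D s -> I s = Lcut r z (F s)} & Lcut r z J = Cint D I].
Proof.
move=> mD BJ r0 z0.
have [mR mI] := measurable_ker setT z.
pose kr (x : R) : R := \1_`[r, +oo[ x * Re (ker z x).
pose ki (x : R) : R := \1_`[r, +oo[ x * Im (ker z x).
have mkr : measurable_fun setT kr by apply: measurable_funM.
have mki : measurable_fun setT ki by apply: measurable_funM.
have ind (x : R) : \1_`[r, +oo[ x = ((r <= x)%R)%:R :> R.
  by rewrite indicE mem_setE in_itv/= andbT.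
have kb x : r <= x -> normc (ker z x) <= 1.
  by move=> rx; apply: normc_ker_le1 => //; exact: le_trans rx.
have kr1 x : `|kr x| <= 1.
  rewrite /kr ind; case: (leP r x) => x0; last by rewrite mul0r normr0.
  by rewrite mul1r (le_trans (Re_le_normc _))// kb.
have ki1 x : `|ki x| <= 1.
  rewrite /ki ind; case: (leP r x) => x0; last by rewrite mul0r normr0.
  by rewrite mul1r (le_trans (Im_le_normc _))// kb.
have LE h : Lcut r z h = (\int[mu]_x (kr x * h x)) +i* (\int[mu]_x (ki x * h x)).
  rewrite /Lcut Cint_mkcond /Cint; congr (_ +i* _); apply: eq_Rintegral => x _.
    by rewrite /kmul mulrA Re_mulr Re_scale.
  by rewrite /kmul mulrA Im_mulr Im_scale.
have [I1 [i1 e1 E1]] := Bochner_pairing mD BJ mkr kr1.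
have [I2 [i2 e2 E2]] := Bochner_pairing mD BJ mki ki1.
exists (fun s => I1 s +i* I2 s); split => //.
- by apply: ae_imply2 e1 e2 => s h1 h2 Ds; rewrite LE h1// h2.
- by rewrite LE E1 E2.
Qed.

(** On the support, which starts at 1, the kernel is at most e^(Im z). This keeps g inside the unit
    disk and also gives the decay needed in [is_Nop_initial]. *)
Lemma normc_FL_le rho z : probability_density rho -> Im z <= 0 ->
  normc (FL rho z) <= expR (Im z).
Proof.
move=> [i1 r0 rz r1] z0; have n1 : null_below1 rho by move=> y y1; apply: rz; exact: ltW.
have ir : mu.-integrable setT (EFin \o (fun x => expR (Im z) * rho x)).
  exact: integrableZl_real.
have -> : expR (Im z) = \int[mu]_x (expR (Im z) * rho x).
  by rewrite RintegralZl// /Rintegral r1 mulr1.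
rewrite FLE; apply: normc_Cint_le => //; first exact: integrable_kmulT.
move=> x _; rewrite normc_kmul ger0_norm//.
have [x1|x1] := ltP x 1; first by rewrite n1// !mulr0.
by rewrite ler_wpM2r// ler_expR -[leRHS]mulr1 ler_wnM2l.
Qed.

Lemma normc_FL_lt1 rho z : probability_density rho -> Im z < 0 -> normc (FL rho z) < 1.
Proof.
move=> hr z0; rewrite (le_lt_trans (normc_FL_le hr (ltW z0)))//.
by rewrite -[ltRHS](@expR0 R) ltr_expR.
Qed.

End Step.

Section Solution.
Context {R : realType}.
Local Notation mu := (@lebesgue_measure R).
Local Notation Rm := (measurableTypeR R).
Local Notation normc := (@Normc.normc R).
Local Notation Re := (@complex.Re R).
Local Notation Im := (@complex.Im R).
Implicit Types (f : R -> R) (z xi : R[i]).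

Lemma density_L1 (rho : R -> R) : probability_density rho -> L1 rho /\ null_below1 rho.
Proof. by case=> i1 _ rz _; split => // y y1; apply: rz; exact: ltW. Qed.

Variables (N : nat) (p : nat -> R)
  (hp0 : forall j, (1 <= j <= N)%N -> 0 <= p j)
  (hp1 : \sum_(1 <= j < N.+1) p j = 1)
  (eta0 : R -> R) (heta0 : probability_density eta0)
  (eta : R -> R -> R) (beta : R -> R)
  (heta : rescaled_coarsening_solution p N eta0 eta beta).

Let eta_density t : 0 <= t -> probability_density (eta t).
Proof. by case: heta => h _ _ _ _; exact: h. Qed.

Let gain s := T1op (Qop p N (eta s)).

Let gain_L1 s : 0 <= s -> L1 (gain s).
Proof.
by move=> /eta_density/density_L1[e1 e2]; apply: L1_T1op; exact: L1_Qop.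
Qed.

Let FL_gain s z : 0 <= s -> Im z <= 0 ->
  FL (gain s) z = ker z 1 * Qpoly p N (FL (eta s) z).
Proof.
move=> s0 z0; have [e1 e2] := density_L1 (eta_density s0).
have q1 : L1 (Qop p N (eta s)) by exact: L1_Qop.
have q2 : null_below1 (Qop p N (eta s)) by exact: null_below1_Qop.
rewrite FL_T1op ?FL_Qop//; first exact: L1_measurable.
exact: integrable_kmulT.
Qed.

Let g xi t : R[i] := FL (eta t) ((expR t)%:C * xi).

Let Im_exp t xi : Im xi < 0 -> Im ((expR t)%:C * xi) < 0.
Proof. by move=> x0; rewrite Im_scale pmulr_rlt0// expR_gt0. Qed.

Let expC (s t : R) xi : (expR s)%:C * ((expR t)%:C * xi) = (expR (s + t))%:C * xi.
Proof. by rewrite mulrA -rmorphM/= -expRD. Qed.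

(** The integral equation at time a, tested at frequency e^a xi beyond r. After [Lcut_Sop] the
    integrand depends on a only through its cut r e^(a - s), so equations at different times can be
    compared. *)
Let Lcut_solution (a r : R) xi : 0 <= a -> 1 <= r -> Im xi < 0 ->
  exists I : R -> R[i], [/\ Cintegrable `[0, a] I,
    {ae mu, forall s, `[0, a]%classic s ->
      I s = (beta s)%:C * Lcut (r * expR (a - s)) ((expR s)%:C * xi) (gain s)} &
    Lcut r ((expR a)%:C * xi) (eta a) = Lcut (r * expR a) xi eta0 + Cint `[0, a] I].
Proof.
move=> a0 r1 x0; have r0 : 0 <= r by rewrite (le_trans _ r1).
have z0 := ltW (Im_exp a x0).
have [_ _ _ hJ _] := heta; have [J BJ eJ] := hJ a a0.
have [e01 e02] := density_L1 heta0.
have [e1 e2] := density_L1 (eta_density a0).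
have mD : measurable (`[0, a]%classic : set R) by [].
have [I [iI IE IJ]] := Lcut_Bochner_pairing mD BJ r0 z0.
have J1 : L1 J by case: BJ.
exists I; split => //.
  apply: ae_imply IE => s Is sa; rewrite Is//.
  have s0 : 0 <= s by move: sa; rewrite /= in_itv/= => /andP[].
  have h1 := gain_L1 s0.
  have -> : Lcut r ((expR a)%:C * xi) (fun y => beta s * Sop (a - s) (gain s) y) =
      (beta s)%:C * Lcut r ((expR a)%:C * xi) (Sop (a - s) (gain s)).
    exact: (LcutZ _ r0 z0 (L1_Sop _ h1)).
  congr (_ * _); rewrite (Lcut_Sop _ _ r1 (L1_measurable h1)).
  by rewrite expC opprB subrK.
have S1 : L1 (Sop a eta0) by exact: L1_Sop.
rewrite (@ae_eq_Lcut _ r _ (eta a) (Sop a eta0 \+ J)) => //; last 2 first.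
- exact: L1_measurable.
- by apply: measurable_funD; exact: L1_measurable.
rewrite (LcutD r0 z0 S1 J1) IJ (Lcut_Sop _ _ r1 (L1_measurable e01)).
by rewrite expC addNr expR0 mul1r.
Qed.

(* Semigroup property of the integral equation, tested against exponentials:
   the parts of the two Bochner integrals over [0, a] agree almost everywhere,
   although the two integrands need not be measurable. *)
Let Lcut_increment (a b : R) xi : 0 <= a -> a <= b -> b <= a + ln 2 -> Im xi < 0 ->
  exists I : R -> R[i], [/\ Cintegrable `[a, b] I,
    {ae mu, forall s, `[a, b]%classic s ->
      I s = (beta s)%:C * (ker xi (expR s) * Qpoly p N (g xi s))} &
    g xi b = Lcut (expR (b - a)) ((expR a)%:C * xi) (eta a) + Cint `[a, b] I].
Proof.
move=> a0 ab b2 x0; have b0 : 0 <= b by rewrite (le_trans a0).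
have eba1 : 1 <= expR (b - a) by rewrite -[leLHS](@expR0 R) ler_expR subr_ge0.
(* Cutting at e^(b - a) at time a and at 1 at time b gives the gain the same cut e^(b - s) in both
   equations. *)
have [Ia [iIa IaE Ea]] := Lcut_solution a0 eba1 x0.
have [Ib [iIb IbE Eb]] := Lcut_solution b0 (lexx 1) x0.
have suba : [set` `[0, a]] `<=` [set` `[0, b]] by apply: subset_itvl; rewrite bnd_simp.
have subb : [set` `[a, b]] `<=` [set` `[0, b]] by apply: subset_itvr; rewrite bnd_simp.
have iIba : Cintegrable `[0, a] Ib by apply: CintegrableS iIb.
exists Ib; split.
- by apply: CintegrableS iIb.
- apply: ae_imply IbE => s Is sab; rewrite Is; last exact: subb.
  move: sab; rewrite /= in_itv/= => /andP[as_ sb].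
  have s0 : 0 <= s by rewrite (le_trans a0).
  (* The gain vanishes below 2 and the cut e^(b - s) is at most 2, so the truncated transform is the
     full one. *)
  congr (_ * _); rewrite mul1r -FL_Lcut; last first.
    move=> x xb; rewrite /gain /T1op leNgt (lt_le_trans xb)//.
    rewrite -[leRHS]lnK ?posrE// ler_expR; lra.
  rewrite FL_gain//; last exact: (ltW (Im_exp s x0)).
  by rewrite ker_scale mulr1.
- have [_ n1] := density_L1 (eta_density b0).
  rewrite /g (FL_Lcut (r := 1))// Eb Ea mul1r -expRD subrK -addrA; congr (_ + _).
  rewrite (Cint_itv_cat a0 ab)//; congr (_ + _).
  apply: ae_eq_Cint => //; [exact: Cintegrable_measurable|exact: Cintegrable_measurable|].
  apply: ae_imply2 IaE IbE => s h1 h2 sa; rewrite h1// h2; last exact: suba.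
  by rewrite -expRD mul1r addrA subrK.
Qed.

Let K xi s : R[i] := (beta s)%:C * ker xi (expR s).

Let beta_int (a b : R) : 0 <= a -> mu.-integrable `[a, b] (EFin \o beta).
Proof.
move=> a0; have [_ _ h _ _] := heta; have [b0|b0] := leP 0 b.
  by apply: integrableS (h b b0) => //; apply: subset_itvr; rewrite bnd_simp.
rewrite set_itv_ge ?bnd_simp -?ltNge ?(lt_le_trans b0)//.
apply/integrableP; split; first exact: measurable_fun_set0.
by rewrite integral_set0.
Qed.

Let K_int (a b : R) xi : 0 <= a -> Im xi < 0 -> Cintegrable `[a, b] (K xi).
Proof.
move=> a0 x0; have ib := @beta_int a b a0.
apply: (le_Cintegrable _ _ (g := fun s => `|beta s|)) => //.
- apply: CmeasurableM.
    by apply: Cmeasurable_real; case/integrableP : ib => /measurable_EFinP.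
  have [m1 m2] := measurable_ker setT xi.
  have me : measurable_fun `[a, b] (@expR R) by apply: measurable_funTS; exact: measurable_expR.
  split; [exact: (measurableT_comp m1 me)|exact: (measurableT_comp m2 me)].
- move=> s _; rewrite /K Normc.normcM normc_real ler_piMr//.
  by apply: normc_ker_le1; [exact: ltW|exact: expR_ge0].
- by move: ib => /integrable_abse; apply: eq_integrable_real.
Qed.

(** Substitution u = e^(s - a): by the trace condition, eta(a)(u) du becomes beta(s) ds. What is
    lost through the boundary 1 between times a and b is exactly the mass of eta(a) on [1, e^(b -
    a)). *)
Let Cint_trace (a b : R) xi : 0 <= a -> a <= b -> b <= a + ln 2 -> Im xi < 0 ->
  Cint `[1, expR (b - a)[ (kmul ((expR a)%:C * xi) (eta a)) = Cint `[a, b] (K xi).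
Proof.
move=> a0 ab b2 x0; have [_ _ _ _ htr] := heta.
have [e1 n1] := density_L1 (eta_density a0); have me := L1_measurable e1.
have s0 : 0 <= b - a by rewrite subr_ge0.
set F := kmul ((expR a)%:C * xi) (eta a).
have [mF1 mF2] : Cmeasurable setT F by exact: measurable_kmul.
have [F1 F2] : Cintegrable `[1, expR (b - a)[ F.
  apply: integrable_kmul_L1 => //; last exact: (ltW (Im_exp a x0)).
  by move=> x /=; rewrite in_itv/= => /andP[x1 _]; exact: le_trans x1.
have [_ E1] := Rintegral_exp s0 F1; have [_ E2] := Rintegral_exp s0 F2.
pose G x : R[i] := (expR x)%:C * F (expR x).
have mG : Cmeasurable setT G.
  apply: CmeasurableM; first by apply: Cmeasurable_real; exact: measurable_expR.
  by split; [apply: (measurableT_comp mF1)|apply: (measurableT_comp mF2)];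
    exact: measurable_expR.
have -> : Cint `[1, expR (b - a)[ F = Cint `[0, b - a[ G.
  rewrite /Cint; congr (_ +i* _).
    by rewrite [LHS]E1; apply: eq_Rintegral => x _; rewrite /G Re_scale.
  by rewrite [LHS]E2; apply: eq_Rintegral => x _; rewrite /G Im_scale.
have mG' : Cmeasurable setT (fun x => (\1_(`[0, b - a[) x)%:C * G x).
  by apply: CmeasurableM => //; exact: Cmeasurable_real.
have GK x : beta x = expR (x - a) * eta a (expR (x - a)) -> G (x - a) = K xi x.
  move=> bx; rewrite /G /F /K /kmul ker_scale -expRD (addrC a) subrK bx rmorphM/=.
  by rewrite [LHS]mulrCA mulrC.
have -> : Cint `[0, b - a[ G = Cint `[a, b[ (fun x => G (x - a)).
  rewrite [LHS]Cint_mkcond (Cint_affine (- a) ltr01 mG') [RHS]Cint_mkcond.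
  apply: eq_Cint => x _; rewrite !mul1r !indicE !mem_setE !in_itv/=.
  by rewrite subr_ge0 ltrD2r.
have iK := @K_int a b xi a0 x0.
have sub1 : [set` `[a, b[] `<=` [set` `[a, b]] by apply: subset_itvl; rewrite bnd_simp.
have iK' : Cintegrable `[a, b[ (K xi) by apply: CintegrableS iK.
rewrite (_ : Cint `[a, b] (K xi) = Cint `[a, b[ (K xi)); last first.
  by case: iK' => k1 k2; rewrite /Cint; congr (_ +i* _);
    apply/esym; exact: Rintegral_itv_bndo_bndc.
apply: ae_eq_Cint => //.
- have mx : measurable_fun `[a, b[ (fun x : R => x - a) by exact: measurable_funB.
  by case: mG => g1 g2; split; [exact: (measurableT_comp g1 mx)|exact: (measurableT_comp g2 mx)].
- exact: Cintegrable_measurable.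
- apply: ae_imply (htr a a0) => x hx xab; apply: GK; apply: hx.
  by move: xab; rewrite /= in_itv/= => /andP[-> /ltW xb]; rewrite (le_trans xb).
Qed.

Let g_step (a b : R) xi : 0 <= a -> a <= b -> b <= a + ln 2 -> Im xi < 0 ->
  g xi a = Cint `[1, expR (b - a)[ (kmul ((expR a)%:C * xi) (eta a)) +
    Lcut (expR (b - a)) ((expR a)%:C * xi) (eta a).
Proof.
move=> a0 ab b2 x0.
have [e1 n1] := density_L1 (eta_density a0).
have eba1 : 1 <= expR (b - a) by rewrite -[leLHS](@expR0 R) ler_expR subr_ge0.
rewrite /g (FL_Lcut (r := 1))// /Lcut.
rewrite (@itv_bndbnd_setU _ _ _ (BLeft (expR (b - a)))) ?bnd_simp//.
rewrite Cint_setU//.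
- rewrite -itv_bndbnd_setU ?bnd_simp//; apply: Lcut_integrable => //.
  exact: (ltW (Im_exp a x0)).
- apply/disj_setPS => x /=; rewrite !in_itv/= andbT => -[/andP[_ h1] h2].
  by move: h1; rewrite ltNge h2.
Qed.

Lemma phi_FL_step (phi : R[i]^o -> R[i]^o) (hphi : is_phi p N phi) (a b : R) z :
  0 <= a -> a <= b -> b <= a + ln 2 -> Im z < 0 ->
  phi (FL (eta b) ((expR (b - a))%:C * z)) =
  phi (FL (eta a) z) - Cint `[1, expR (b - a)[ (kmul z (eta a)).
Proof.
move=> a0 ab b2 z0; pose xi := (expR (- a))%:C * z.
have x0 : Im xi < 0 by exact: Im_exp.
have zE : z = (expR a)%:C * xi by rewrite expC subrr expR0 mul1r.
rewrite {2 3}zE Cint_trace// -/(g xi a).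
have -> : FL (eta b) ((expR (b - a))%:C * z) = g xi b by rewrite zE expC subrK.
apply: (primitive_along_curve hp0 hp1 hphi ab).
- move=> t /andP[at_ tb]; apply: normc_FL_lt1; last exact: Im_exp.
  by apply: eta_density; exact: le_trans at_.
- exact: K_int.
- move=> s t as_ st tb.
  have s0 : 0 <= s by rewrite (le_trans a0).
  have t2 : t <= s + ln 2 by lra.
  have [I [iI IE E]] := Lcut_increment s0 st t2 x0.
  have iK := @K_int s t xi s0 x0.
  (* Loss minus gain: the untouched part beyond the cut cancels between [g_step] and
     [Lcut_increment]. *)
  exists (fun u => K xi u - I u); split.
  + exact: CintegrableB.
  + by apply: ae_imply IE => u Iu stu; rewrite Iu// /K; ring.
  + rewrite CintB// E (g_step s0 st t2 x0) Cint_trace//; ring.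
Qed.

(** At time 0 the gain is integrated over a single point. Equality of transforms is all that
    [is_Nop] sees of a density. *)
Lemma FL_initial z : Im z < 0 -> FL (eta 0) z = FL eta0 z.
Proof.
move=> z0; have [_ n0] := density_L1 heta0; have [_ n1] := density_L1 (eta_density (lexx 0)).
have [I [_ _ E]] := Lcut_solution (lexx 0) (lexx 1) z0.
rewrite (FL_Lcut (r := 1))// [in RHS](FL_Lcut (r := 1))//.
move: E; rewrite expR0 mulr1 rmorph1 mul1r => ->.
rewrite set_itv1 (_ : Cint _ _ = 0) ?addr0//.
by apply: complex_eq; rewrite /= Rintegral_set1.
Qed.

End Solution.

(** * The map N *)

Section Uniqueness.
Context {R : realType}.
Local Notation mu := (@lebesgue_measure R).
Local Notation Rm := (measurableTypeR R).
Local Notation normc := (@Normc.normc R).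
Local Notation Re := (@complex.Re R).
Local Notation Im := (@complex.Im R).
Implicit Types (f w : R -> R) (z xi : R[i]).

Lemma FL_imag w (l : R) : FL w (0 +i* (- l)) = (\int[mu]_x (expR (- l * x) * w x))%:C.
Proof.
rewrite FLE /Cint; congr (_ +i* _).
  apply: eq_Rintegral => x _; rewrite /kmul Re_mulr kerE [Re (_ +i* _)]/=.
  by rewrite mul0r cos0 mulr1.
rewrite -[RHS](@mul0r R (fine (mu setT))) -Rintegral_cst//.
apply: eq_Rintegral => x _; rewrite /kmul Im_mulr kerE [Im (_ +i* _)]/=.
by rewrite mul0r sin0 mulr0 oppr0 mul0r.
Qed.

(** The difference has zero Laplace transform at every positive l, so [laplace_vanish] applies with
    C = 0 on each half-line below n. *)
Lemma is_Nop_unique phi rho w w' : is_Nop phi rho w -> is_Nop phi rho w' ->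
  ae_eq mu setT w w'.
Proof.
move=> [m1 z1 i1 F1] [m2 z2 i2 F2].
pose d x := w x - w' x.
have md : measurable_fun setT d by exact: measurable_funB.
have d0 x : x < 0 -> d x = 0.
  by move=> x0; rewrite /d z1 ?z2 ?subrr//; exact: lt_trans ltr01.
have dE (l : R) : 0 < l ->
    mu.-integrable setT (EFin \o (fun x => expR (- l * x) * d x)) /\
    \int[mu]_x (expR (- l * x) * d x) = 0.
  move=> l0; split.
    have := integrableD_real measurableT (i1 l l0) (integrableZl_real (-1) measurableT (i2 l l0)).
    by apply: eq_integrable_real => // x _; rewrite /d; ring.
  under eq_Rintegral do rewrite /d mulrBr.
  have := F2 (0 +i* (- l)); have := F1 (0 +i* (- l)); rewrite /= oppr_lt0 !FL_imag.
  move=> /(_ l0) E1 /(_ l0); rewrite -E1 => -[E2].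
  rewrite RintegralB//; [|exact: i1|exact: i2].
  by rewrite E2 subrr.
have H (n : nat) : {ae mu, forall x, x < n%:R -> d x = 0}.
  apply: (@laplace_vanish R d n%:R 0) => //.
    have := (dE 1 ltr01).1; apply: eq_integrable_real => // x _.
    by rewrite mulN1r.
  move=> m m0; have l0 : 0 < m%:R :> R by rewrite ltr0n.
  by have [h1 h2] := dE _ l0; rewrite h2 normr0 mul0r.
have := ae_foralln H; apply: ae_imply => x hx _.
apply/eqP; rewrite -subr_eq0; apply/eqP; apply: (hx (Num.bound `|x|)).
exact: le_lt_trans (ler_norm x) (archi_boundP (normr_ge0 x)).
Qed.

Section PhiNearZero.
Variables (N : nat) (p : nat -> R)
  (hp0 : forall j, (1 <= j <= N)%N -> 0 <= p j)
  (hp1 : \sum_(1 <= j < N.+1) p j = 1)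
  (phi : R[i]^o -> R[i]^o) (hphi : is_phi p N phi).

(** On [0, r] one has phi' - 1 = Q / (1 - Q), with |Q| <= r and |1 - Q| >= 1/2, hence |phi' - 1| <=
    2 r. The mean value inequality with a linear comparison function concludes, with slack e from
    the derivative estimate. *)
Lemma phi_quadratic (r : R) : 0 <= r <= 2^-1 ->
  `|Re (phi r%:C) - r| <= 2 * r ^+ 2.
Proof.
move=> /andP[r0 r2].
pose Psi t := Re (phi t%:C) - t.
suff H e : 0 < e -> `|Psi r - Psi 0| <= (2 * r + e) * r - (2 * r + e) * 0.
  have P0 : Psi 0 = 0 by rewrite /Psi [phi _]hphi.1 subr0.
  apply/ler_addgt0Pr => e e0; have := H e e0; rewrite P0 subr0 mulr0 subr0.
  by move=> /le_trans; apply; nra.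
move=> e0.
apply: (@locally_dominated_le R Psi (fun t => (2 * r + e) * t)) => //.
  by move=> s t _ st _; rewrite ler_wpM2l// addr_ge0// ?mulr_ge0// ltW.
move=> t /andP[t0 tr].
have t2 : t <= 2^-1 by exact: le_trans r2.
have nt : normc t%:C = t by rewrite normc_real ger0_norm.
have t1 : normc t%:C < 1 by rewrite nt (le_lt_trans t2)// invf_lt1// ltr1n.
have tC : `|t%:C : R[i]| < 1 by rewrite normrC_normc ltcR.
have [d d0 hd] := is_derive_normc (hphi.2 t%:C tC) e0.
exists d => // s _ std.
set c := (1 - Qpoly p N t%:C)^-1.
have c1 : normc (c - 1) <= 2 * r.
  have c00 := one_sub_Qpoly_neq0 hp0 hp1 t1.
  have -> : c - 1 = Qpoly p N t%:C * c.
    by rewrite /c; apply: (mulIf c00); rewrite mulrBl -mulrA mulVf// mulr1 mul1r subKr.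
  have Qt := normc_Qpoly_le hp0 hp1 (ltW t1).
  rewrite nt in Qt.
  have h : 2^-1 <= normc (1 - Qpoly p N t%:C).
    have := ler_normcD (1 - Qpoly p N t%:C) (Qpoly p N t%:C).
    rewrite subrK Normc.normc1; lra.
  have c2 : normc c <= 2.
    have h0 : 0 < normc (1 - Qpoly p N t%:C) by apply: lt_le_trans h; rewrite invr_gt0.
    by rewrite /c Normc.normcV -(invrK 2) lef_pV2// posrE invr_gt0.
  rewrite Normc.normcM mulrC ler_pM ?normc_ge0//.
  exact: le_trans Qt tr.
have := hd (s - t)%:C; rewrite normc_real => /(_ std).
rewrite -rmorphD/= subrKC -/c => hs.
rewrite (_ : Psi s - Psi t =
    Re ((phi s%:C - phi t%:C - c * (s - t)%:C) + (c - 1) * (s - t)%:C)); last first.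
  by rewrite /Psi !Re_addc !Re_oppc !Re_mulr !Re_addc Re_oppc /=; ring.
rewrite (le_trans (Re_le_normc _))// (le_trans (ler_normcD _ _))//.
rewrite -mulrBr normrM (ger0_norm (_ : 0 <= 2 * r + e)); last first.
  by rewrite addr_ge0// ?mulr_ge0// ltW.
rewrite [leRHS]mulrDl [leRHS]addrC lerD// Normc.normcM normc_real ler_wpM2r//.
Qed.

Lemma is_Nop_initial rho w : probability_density rho -> is_Nop phi rho w ->
  {ae mu, forall x, x < 2 -> w x = rho x}.
Proof.
move=> hr [mw zw iw Fw]; have [r1 n1] := density_L1 hr; have mr := L1_measurable r1.
pose d x := w x - rho x.
have md : measurable_fun setT d by exact: measurable_funB.
have ir (l : R) : 0 < l -> mu.-integrable setT (EFin \o (fun x => expR (- l * x) * rho x)).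
  move=> l0; move: (r1) => /integrable_abse; apply: le_integrable_real => //.
    apply: measurable_funM => //; apply: measurableT_comp; first exact: measurable_expR.
    exact: measurable_funM.
  move=> x _ /=; have [x1|x1] := ltP x 1; first by rewrite n1// mulr0 normr0.
  rewrite normrM (ger0_norm (expR_ge0 _)) ler_piMl//.
  by rewrite -[leRHS](@expR0 R) ler_expR mulNr oppr_le0 mulr_ge0 ?(ltW l0)// (le_trans _ x1).
have id (l : R) : 0 < l -> mu.-integrable setT (EFin \o (fun x => expR (- l * x) * d x)).
  move=> l0.
  have := integrableD_real measurableT (iw l l0) (integrableZl_real (-1) measurableT (ir l l0)).
  by apply: eq_integrable_real => // x _; rewrite /d; ring.
suff H : {ae mu, forall x, x < 2 -> d x = 0}.
  by apply: ae_imply H => x hx /hx /eqP; rewrite subr_eq0 => /eqP.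
(* At frequency n the transform of [d] is phi(r) - r, where 0 <= r <= e^(-n) is that of [rho]. So it
   is at most 2 r^2 <= 2 e^(-2 n), which gives both constants; r <= 1/2 follows from e >= 2. *)
apply: (@laplace_vanish R d 2 2) => //.
- by move=> x x0; have x1 := lt_trans x0 ltr01; rewrite /d zw// n1// subr0.
- by have := id 1 ltr01; apply: eq_integrable_real => // x _; rewrite mulN1r.
move=> n n0; have l0 : 0 < n%:R :> R by rewrite ltr0n.
split; first exact: id.
under eq_Rintegral do rewrite /d mulrBr.
rewrite RintegralB//; [|exact: iw|exact: ir].
have z0 : Im (0 +i* (- n%:R)) < 0 by rewrite /= oppr_lt0.
have := Fw _ z0; rewrite !FL_imag; set r := \int[mu]_x (_ * rho x) => E.
have r0 : 0 <= r.
  by apply: Rintegral_ge0 => x _; rewrite mulr_ge0 ?expR_ge0//; case: hr.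
have rb : r <= expR (- n%:R).
  have := normc_FL_le hr (ltW z0); rewrite FL_imag -/r normc_real.
  by rewrite ger0_norm.
have e2 : 2 <= expR 1 :> R by exact: expR_ge1Dx.
have rb2 : r <= 2^-1.
  apply: (le_trans rb); apply: (@le_trans _ _ (expR (- 1))).
    by rewrite ler_expR lerN2 ler1n.
  by rewrite expRN lef_pV2// ?posrE ?expR_gt0.
have -> : \int[mu]_x (expR (- n%:R * x) * w x) = Re (phi r%:C) by rewrite -E.
have := @phi_quadratic r; rewrite r0 rb2 => /(_ isT) /le_trans; apply.
rewrite ler_wpM2l// (_ : - n%:R * 2 = (- n%:R) + (- n%:R)); last by ring.
by rewrite expRD expr2 ler_pM.
Qed.

End PhiNearZero.
End Uniqueness.

(** * Transport of N along the solution *)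

Section Transfer.
Context {R : realType}.
Local Notation mu := (@lebesgue_measure R).
Local Notation Rm := (measurableTypeR R).
Local Notation Re := (@complex.Re R).
Local Notation Im := (@complex.Im R).
Implicit Types (f w v : R -> R) (z xi : R[i]).

Lemma integrable_expR_Sop s w : (forall e, 0 < e ->
    mu.-integrable setT (EFin \o (fun x => expR (- e * x) * w x))) ->
  measurable_fun setT w -> forall e, 0 < e ->
    mu.-integrable setT (EFin \o (fun x => expR (- e * x) * Sop s w x)).
Proof.
move=> iw mw e e0.
(* The scaling stretches the argument by e^s, so decay at rate e after it is decay at rate e e^(-s)
   before it. *)
have e1 : 0 < e * expR (- s) by rewrite mulr_gt0// expR_gt0.
have := integrable_affine 0 (expR_gt0 s) (iw _ e1).
move=> /integrable_abse; apply: le_integrable_real => //.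
  apply: measurable_funM; last exact: measurable_Sop.
  by apply: measurableT_comp; [exact: measurable_expR|exact: measurable_funM].
move=> x _ /=; rewrite addr0 /Sop; case: ifP => _; last by rewrite mulr0 normr0.
rewrite mulrCA.
rewrite (_ : - (e * expR (- s)) * (expR s * x) = - e * (expR (- s + s) * x)); last first.
  by rewrite expRD; ring.
by rewrite addNr expR0 mul1r.
Qed.

Lemma Cintegrable_kmul_Nop phi rho w z D : is_Nop phi rho w -> Im z < 0 ->
  measurable D -> Cintegrable D (kmul z w).
Proof.
move=> [mw zw iw _] z0 mD; have e0 : 0 < - Im z by rewrite oppr_gt0.
apply: integrable_kmul => //; first exact: measurable_funTS.
have := iw _ e0; rewrite opprK => h.
by apply: integrableS h.
Qed.

Lemma FL_split (r : R) z w : 1 <= r -> (forall x, x < 1 -> w x = 0) ->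
  Cintegrable `[1, +oo[ (kmul z w) ->
  FL w z = Cint `[1, r[ (kmul z w) + Lcut r z w.
Proof.
move=> r1 w0 iw; rewrite (FL_Lcut (r := 1))// /Lcut.
have E : `[1, +oo[%classic = `[1, r[%classic `|` `[r, +oo[%classic :> set R.
  by rewrite -itv_bndbnd_setU ?bnd_simp.
rewrite E Cint_setU -?E//.
apply/disj_setPS => x /=; rewrite !in_itv/= andbT => -[/andP[_ h1] h2].
by move: h1; rewrite ltNge h2.
Qed.

(** Only the outer time must be nonnegative: then [1 <= y] implies that e^t y passes the inner
    truncation. *)
Lemma SopD s t f : 0 <= t -> Sop t (Sop s f) = Sop (s + t) f.
Proof.
move=> t0; apply/funext => y; rewrite /Sop; case: ifPn => // y1.
rewrite ifT; first by rewrite mulrA -expRD mulrA -expRD addrC.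
rewrite (le_trans y1)// ler_peMl//; first exact: le_trans y1.
by rewrite -[leLHS](@expR0 R) ler_expR.
Qed.

Lemma ae_eq_Sop s f g : ae_eq mu setT f g -> ae_eq mu setT (Sop s f) (Sop s g).
Proof.
move=> [A [mA A0 subA]].
have mT : measurable_fun setT ((fun x => expR s * x) : Rm -> Rm) by exact: measurable_funM.
have mpre : measurable ((fun x => expR s * x) @^-1` A : set Rm).
  by rewrite -[X in measurable X]setTI; exact: mT.
exists ((fun x => expR s * x) @^-1` A); split => //.
- have mA1 : measurable_fun [set: Rm] (EFin \o (\1_A : Rm -> R)).
    by apply/measurable_EFinP; exact: measurable_indic.
  have A1 x : (0 <= (EFin \o \1_A) x :> \bar R)%E by rewrite /= lee_fin.
  (* Scaling preserves null sets: the measure of [A] is e^s times that of its preimage. *)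
  have := ge0_integral_affine 0 (expR_gt0 s) mA1 A1.
  rewrite integral_indic// setIT A0.
  under [RHS]eq_integral do rewrite addr0.
  rewrite ge0_integralZl//; last exact: (measurableT_comp mA1 mT).
  move=> /esym/eqP; rewrite mule_eq0 eqe gt_eqF ?expR_gt0//= => /eqP.
  rewrite (_ : (fun x => _) = EFin \o \1_((fun x => expR s * x) @^-1` A))//.
  by rewrite integral_indic// setIT.
- move=> x /= h; apply: contrapT => hA; apply: h => _.
  rewrite /Sop; case: ifP => // _; congr (_ * _).
  by apply: contrapT => h2; apply: hA; apply: subA => /= h3; apply: h2; exact: h3.
Qed.

Section Step.
Variables (N : nat) (p : nat -> R)
  (hp0 : forall j, (1 <= j <= N)%N -> 0 <= p j)
  (hp1 : \sum_(1 <= j < N.+1) p j = 1)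
  (phi : R[i]^o -> R[i]^o) (hphi : is_phi p N phi)
  (eta0 : R -> R) (heta0 : probability_density eta0)
  (eta : R -> R -> R) (beta : R -> R)
  (heta : rescaled_coarsening_solution p N eta0 eta beta).

Let eta_density t : 0 <= t -> probability_density (eta t).
Proof. by case: heta => h _ _ _ _; exact: h. Qed.

Section OneStep.
Variables (a b : R).
Hypotheses (a0 : 0 <= a) (ab : a <= b) (b2 : b <= a + ln 2).

Let s := b - a.
Let s0 : 0 <= s. Proof. by rewrite subr_ge0. Qed.
Let es1 : 1 <= expR s. Proof. by rewrite -[leLHS](@expR0 R) ler_expR. Qed.
Let es2 : expR s <= 2.
Proof. by rewrite -[leRHS]lnK ?posrE// ler_expR /s lerBlDl. Qed.

Let scaleK z : (expR s)%:C * ((expR (- s))%:C * z) = z.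
Proof. by rewrite mulrA -rmorphM/= -expRD subrr expR0 mul1r. Qed.

Let Im_exp (t : R) z : Im z < 0 -> Im ((expR t)%:C * z) < 0.
Proof. by move=> x0; rewrite Im_scale pmulr_rlt0// expR_gt0. Qed.

Lemma is_Nop_forward w : is_Nop phi (eta a) w -> is_Nop phi (eta b) (Sop s w).
Proof.
move=> hw; have [mw zw iw Fw] := hw.
have zS y : y < 1 -> Sop s w y = 0 by move=> y1; rewrite /Sop leNgt y1.
split; [exact: measurable_Sop|exact: zS|exact: integrable_expR_Sop|].
move=> z z0; pose zeta := (expR (- s))%:C * z.
have ze0 : Im zeta < 0 by exact: Im_exp.
rewrite -[in RHS](scaleK z) -/zeta (phi_FL_step hp0 hp1 heta0 heta hphi a0 ab b2 ze0).
rewrite -Fw// (FL_split es1 zw); last exact: Cintegrable_kmul_Nop hw _ _.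
rewrite (FL_Lcut (r := 1))// Lcut_Sop// mul1r -/zeta.
(* As e^s <= 2, [w] and [eta a] agree almost everywhere on [1, e^s), so what [Sop] removes from [w]
   is what [phi_FL_step] subtracts. *)
rewrite [X in _ = X + _ - _](_ : _ = Cint `[1, expR s[ (kmul zeta (eta a))).
  by rewrite addrAC subrr add0r.
have [e1 _] := density_L1 (eta_density a0).
apply: ae_eq_Cint => //.
- by apply: measurable_kmul; exact: measurable_funTS.
- by apply: measurable_kmul; apply: measurable_funTS; exact: L1_measurable.
apply: ae_imply (is_Nop_initial hp0 hp1 hphi (eta_density a0) hw) => x hx xs.
rewrite /kmul hx//; move: xs; rewrite /= in_itv/= => /andP[_ /lt_le_trans]; exact.
Qed.

Lemma is_Nop_backward v : is_Nop phi (eta b) v ->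
  is_Nop phi (eta a) (fun u => if u < expR s then eta a u else Sop (- s) v u).
Proof.
move=> hv; have [mv zv iv Fv] := hv; set w := fun u => _.
have [e1 n1] := density_L1 (eta_density a0); have me := L1_measurable e1.
have mS : measurable_fun setT (Sop (- s) v) by exact: measurable_Sop.
have mw : measurable_fun setT w.
  by apply: measurable_fun_ifT => //; apply: measurable_fun_ltr.
have zw y : y < 1 -> w y = 0.
  by move=> y1; rewrite /w (lt_le_trans y1 es1) n1.
have iw e : 0 < e -> mu.-integrable setT (EFin \o (fun x => expR (- e * x) * w x)).
  move=> e0.
  have i1 : mu.-integrable setT (EFin \o (fun x => `|eta a x|)).
    by move: e1 => /integrable_abse; apply: eq_integrable_real.
  have i2 : mu.-integrable setT (EFin \o (fun x => `|expR (- e * x) * Sop (- s) v x|)).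
    have := integrable_expR_Sop (- s) iv mv e0.
    by move=> /integrable_abse; apply: eq_integrable_real.
  have := integrableD_real measurableT i1 i2; apply: le_integrable_real => //.
    apply: measurable_funM => //.
    by apply: measurableT_comp; [exact: measurable_expR|exact: measurable_funM].
  move=> x _; rewrite /w; case: ifP => _; last by rewrite lerDr.
  have [x1|x1] := ltP x 1; first by rewrite n1// mulr0 normr0 add0r.
  rewrite (le_trans _ (_ : `|eta a x| <= _))// ?lerDl//.
  rewrite normrM (ger0_norm (expR_ge0 _)) ler_piMl//.
  by rewrite -[leRHS](@expR0 R) ler_expR mulNr oppr_le0 mulr_ge0 ?(ltW e0)// (le_trans _ x1).
split => // zeta ze0; pose z := (expR s)%:C * zeta.
have z0 : Im z < 0 by exact: Im_exp.
have iwc : Cintegrable `[1, +oo[ (kmul zeta w).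
  apply: integrable_kmul => //; first exact: measurable_funTS.
  have e0 : 0 < - Im zeta by rewrite oppr_gt0.
  by have := iw _ e0; rewrite opprK => h; apply: integrableS h.
rewrite (FL_split es1 zw iwc).
rewrite (_ : Cint _ _ = Cint `[1, expR s[ (kmul zeta (eta a))); last first.
  by apply: eq_Cint => x; rewrite inE/= in_itv/= /kmul /w => /andP[_ ->].
rewrite (_ : Lcut _ _ w = Lcut (expR s) zeta (Sop (- s) v)); last first.
  by apply: eq_Cint => x; rewrite inE/= in_itv/= andbT /kmul /w ltNge => ->.
(* Undoing the scaling moves the cut from e^s to 1, where it is invisible because [v] vanishes below
   1. *)
rewrite Lcut_Sop// -expRD subrr expR0 opprK -FL_Lcut// Fv//.
by rewrite (phi_FL_step hp0 hp1 heta0 heta hphi a0 ab b2 ze0) addrC subrK.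
Qed.

Lemma Nop_step : ae_eq mu setT (Nop phi (eta b)) (Sop s (Nop phi (eta a))).
Proof.
have [[w hw]|nw] := pselect (exists w, is_Nop phi (eta a) w).
  have hNa : is_Nop phi (eta a) (Nop phi (eta a)) by exact: xgetPex (ex_intro _ w hw).
  have hS := is_Nop_forward hNa.
  have hNb : is_Nop phi (eta b) (Nop phi (eta b)) by exact: xgetPex (ex_intro _ _ hS).
  exact: is_Nop_unique hNb hS.
(* Without a value at a there is none at b; both choices are then the default 0, which [Sop]
   preserves. *)
rewrite /Nop !xgetPN; last 2 first.
- by move=> w hw; apply: nw; exists w.
- by move=> v /is_Nop_backward hv; apply: nw; eexists; exact: hv.
by apply/aeW => y _; rewrite /Sop /= mulr0 if_same.
Qed.

End OneStep.

Lemma Nop_initial : Nop phi (eta 0) = Nop phi eta0.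
Proof.
rewrite /Nop; congr (xget _ _); apply/seteqP; split => w [mw zw iw Fw]; split => // z z0.
  by rewrite -(FL_initial heta0 heta z0) Fw.
by rewrite (FL_initial heta0 heta z0) Fw.
Qed.

(** Needed at time 0, where [Sop] still truncates below 1; the default choice 0 satisfies it too. *)
Lemma Nop_below1 rho y : y < 1 -> Nop phi rho y = 0.
Proof.
move=> y1; rewrite /Nop; case: xgetP => [w _ [_ zw _ _]|]; last by [].
exact: zw.
Qed.

Lemma Nop_solution (n : nat) t : 0 <= t -> t <= n%:R * ln 2 ->
  ae_eq mu setT (Nop phi (eta t)) (Sop t (Nop phi eta0)).
Proof.
elim: n t => [|n IH] t t0 tn.
  have -> : t = 0 by apply/eqP; rewrite eq_le t0 (le_trans tn)// mul0r.
  apply/aeW => y _; rewrite Nop_initial /Sop expR0 !mul1r.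
  by case: leP => // y1; rewrite Nop_below1.
(* The last step has length at most ln 2; the maximum covers times t < ln 2, where it starts at
   0. *)
pose a := Num.max 0 (t - ln 2).
have l2 : 0 < ln 2 :> R by rewrite ln_gt0// ltr1n.
have a0 : 0 <= a by rewrite le_max lexx.
have at_ : a <= t by rewrite ge_max t0 gerBl ltW.
have ta : t <= a + ln 2 by rewrite -lerBlDr le_max lexx orbT.
have an : a <= n%:R * ln 2.
  rewrite ge_max mulr_ge0 ?(ltW l2)//= lerBlDr (le_trans tn)//.
  by rewrite -natr1 mulrDl mul1r.
have h1 := Nop_step a0 at_ ta.
have h2 := ae_eq_Sop (t - a) (IH a a0 an).
apply: ae_imply2 h1 h2 => y e1 e2 _.
by rewrite e1// e2// SopD ?subr_ge0// subrKC.
Qed.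

End Step.
End Transfer.

Theorem proposition3p4 (R : realType) (N : nat) (p : nat -> R)
    (hN : (1 <= N)%N)
    (hp0 : forall j, (1 <= j <= N)%N -> 0 <= p j)
    (hp1 : \sum_(1 <= j < N.+1) p j = 1)
    (phi : R[i]^o -> R[i]^o) (hphi : is_phi p N phi)
    (eta0 : R -> R) (heta0 : probability_density eta0)
    (eta : R -> R -> R) (beta : R -> R)
    (heta : rescaled_coarsening_solution p N eta0 eta beta)
    (tau : R) (htau : 0 <= tau) :
  ae_eq (@lebesgue_measure R) setT (Nop phi (eta tau)) (Sop tau (Nop phi eta0)).
Proof.
have l2 : 0 < ln 2 :> R by rewrite ln_gt0// ltr1n.
(* Enough steps of length ln 2 to reach tau, by the Archimedean property. *)
apply: (Nop_solution hp0 hp1 hphi heta0 heta (n := Num.bound (tau / ln 2))) => //.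
rewrite -ler_pdivrMr//; apply/ltW/archi_boundP.
by rewrite divr_ge0// ltW.
Qed.
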